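(* Consider the time-discontinuous Galerkin scheme for the mechanical phase with homogeneous data ($\bm{f}=\bm{0}$, $\bar{\mathbf{t}}=\bm{0}$, $\bar{\bm{u}}=\bm{0}$): for $n=0,1,\dots,N-1$, given $\bm{U}^h(t_n^-)=(\bm{u}^h(t_n^-),\bm{v}^h(t_n^-))$, find $\bm{U}^h=(\bm{u}^h,\bm{v}^h)\in\mathcal{W}_h(Q_n)\times\mathcal{W}_h(Q_n)$ such that for all $(\bm{w}^h,\bm{\varphi}^h)\in\mathcal{W}_h(Q_n)\times\mathcal{W}_h(Q_n)$ $$(\dot{\bm{u}}^h,\bm{w}^h)_{Q_n}-(\bm{v}^h,\bm{w}^h)_{Q_n}+(\rho\dot{\bm{v}}^h,\bm{\varphi}^h)_{Q_n}+(\mathbb{C}_{ad}\bm{\varepsilon}(\bm{u}^h),\bm{\varepsilon}(\bm{\varphi}^h))_{Q_n}+\langle\bm{u}^h(t_n^+),\bm{w}^h(t_n^+)\rangle+\langle\rho\bm{v}^h(t_n^+),\bm{\varphi}^h(t_n^+)\rangle$$ $$=\langle\bm{u}^h(t_n^-),\bm{w}^h(t_n^+)\rangle+\langle\rho\bm{v}^h(t_n^-),\bm{\varphi}^h(t_n^+)\rangle ,$$ where the initial data $\bm{u}^h(t_0^-),\bm{v}^h(t_0^-)$ belong to $\mathcal{W}_h$. Then the scheme is unconditionally stable: for arbitrary time step lengths, $$\mathscr{E}_M(\bm{U}^h(t_{n+1}^-))\le\mathscr{E}_M(\bm{U}^h(t_n^-))\qquad\text{for all }n=0,1,\dots,N-1,$$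 where $$\mathscr{E}_M(\bm{U})=\frac12\int_\Omega\big[\bm{\varepsilon}(\bm{u}):\mathbb{C}_{ad}\bm{\varepsilon}(\bm{u})+\rho\,\bm{v}\cdot\bm{v}\big]\,\mathrm{d}\Omega,\qquad \bm{U}=(\bm{u},\bm{v}).$$
   Context: $\Omega\subset\mathbb{R}^d$, $1\le d\le3$, is a bounded domain with boundary $\Gamma=\overline{\Gamma_{\bm{u}}\cup\Gamma_{\bm{t}}}$, $\Gamma_{\bm{u}}\cap\Gamma_{\bm{t}}=\emptyset$. $\bm{T}_h=\{\Omega^e\}$ is a triangulation of $\bar\Omega$ (the same for all time slabs), $\mathscr{P}_h^j=\{\varphi_h\in C^0(\bar\Omega):\varphi_h|_{\Omega^e}\in P^j(\Omega^e)\ \forall\,\Omega^e\in\bm{T}_h\}$ with $P^j(\Omega^e)$ the polynomials of degree at most $j$ on $\Omega^e$. The time interval $[0,T]$ is partitioned as $0=t_0<t_1<\dots<t_N=T$, $I_n=[t_n,t_{n+1}]$, $Q_n=\bar\Omega\times I_n$. $\mathcal{S}_h(Q_n;j,l)$ is the set of functions $\phi(\bm{x},t)=\sum_{i=0}^l\varphi_i(\bm{x})t^i$ on $Q_n$ with $\varphi_i\in\mathscr{P}_h^j$. $\mathcal{W}_h(Q_n)=\{\bm{w}\in[\mathcal{S}_h(Q_n;j,l)]^d:\bm{w}=\bm{0}\text{ on }\Gamma_{\bm{u}}\times I_n\}$ and $\mathcal{W}_h=\{\bm{w}\in[\mathscr{P}_h^j]^d:\bm{w}=\bm{0}\text{ on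 }\Gamma_{\bm{u}}\}$. The discrete solution may be discontinuous in time at each $t_n$: $\varphi(t_n^\pm)=\lim_{\epsilon\to0^\pm}\varphi(t_n+\epsilon)$, so that $\varphi(t_n^+)$ is the value from slab $Q_n$ and $\varphi(t_n^-)$ the final value from slab $Q_{n-1}$ (or the initial datum if $n=0$). $\langle\cdot,\cdot\rangle$ is the spatial $L^2(\Omega)$ inner product and $(\varphi,\psi)_{Q_n}=\int_{I_n}\langle\varphi,\psi\rangle\,\mathrm{d}t$; dots denote time derivatives. $\bm{\varepsilon}(\bm{u})=\mathrm{sym}(\nabla\bm{u})$. The material data are constants: $\rho,c,\Theta_0>0$; $\mathbb{C}$ satisfies $\mathbb{C}_{ijkl}=\mathbb{C}_{jikl}=\mathbb{C}_{ijlk}=\mathbb{C}_{klij}$ and $\mathbb{C}_{ijkl}\epsilon_{ij}\epsilon_{kl}>0$ for every nonzero symmetric $\epsilon$; $\mathbf{m}=3\omega\kappa\mathbf{1}$ with real constants $\omega,\kappa$; $\mathbb{C}_{ad}=\mathbb{C}+(\Theta_0/c)\,\mathbf{m}\otimes\mathbf{m}$ is the adiabatic elasticity tensor. *)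

(* Defs.v *)
From HB Require Import structures.
From mathcomp Require Import all_boot all_order all_algebra.
(* The notations of mpoly clash with those of the analysis library. *)
From mathcomp Require Import -(notations) mpoly.
From mathcomp Require Import all_classical all_reals all_analysis.

Set Implicit Arguments.
Unset Strict Implicit.
Unset Printing Implicit Defensive.

Import Order.TTheory GRing.Theory Num.Theory numFieldNormedType.Exports.

Local Open Scope classical_set_scope.
Local Open Scope ring_scope.

Fact rV_display : measure_display. Proof. exact: default_measure_display. Qed.

Definition rV_coord (R : realType) (d : nat) (i : 'I_d) (x : 'rV[R]_d) :
  measurableTypeR R := x ord0 i.

Section measurable_rV.
Variables (R : realType) (d : nat).

Let rV_set0 : g_sigma_preimage (@rV_coord R d) set0.
Proof. exact: sigma_algebra0. Qed.

Let rV_setC A : g_sigma_preimage (@rV_coord R d) A ->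
  g_sigma_preimage (@rV_coord R d) (~` A).
Proof. exact: sigma_algebraC. Qed.

Let rV_bigcup (F : (set 'rV[R]_d)^nat) :
  (forall i, g_sigma_preimage (@rV_coord R d) (F i)) ->
  g_sigma_preimage (@rV_coord R d) (\bigcup_i (F i)).
Proof. exact: sigma_algebra_bigcup. Qed.

(* The product (hence Borel) sigma-algebra, generated by the coordinates. *)
HB.instance Definition _ := @isMeasurable.Build rV_display 'rV[R]_d
  (g_sigma_preimage (@rV_coord R d)) rV_set0 rV_setC rV_bigcup.

End measurable_rV.

Lemma measurable_rV_coord (R : realType) (d : nat) (i : 'I_d) :
  measurable_fun [set: 'rV[R]_d] (rV_coord i).
Proof.
move=> _ Y mY; rewrite setTI; apply: sub_sigma_algebra => /=.
rewrite -bigcup_seq/=; exists i => /=; first by rewrite mem_index_enum.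
by exists Y => //; rewrite setTI.
Qed.

Lemma measurable_fun_rV (R : realType) (d : nat) (d' : measure_display)
    (T : measurableType d') (f : T -> 'rV[R]_d) :
  (forall i, measurable_fun [set: T] (rV_coord i \o f)) ->
  measurable_fun [set: T] f.
Proof.
move=> mf; suff prefS : g_sigma_preimage (fun i => rV_coord i \o f) `<=` measurable.
  by move=> _ A mA; apply: prefS; rewrite g_sigma_preimage_comp; exists A.
apply: smallest_sub; first exact: sigma_algebra_measurable.
rewrite -bigcup_seq/=; apply: bigcup_sub => i _.
by move=> A [B mB <-]; exact: mf.
Qed.

Definition rV_cons (R : realType) (d : nat)
  (p : measurableTypeR R * 'rV[R]_d) : 'rV[R]_(1 + d) :=
  row_mx (const_mx p.1) p.2.

Definition rV_uncons (R : realType) (d : nat) (x : 'rV[R]_(1 + d)) :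
  measurableTypeR R * 'rV[R]_d := (x ord0 (lshift d ord0), rsubmx x).

Lemma rV_consK (R : realType) (d : nat) :
  cancel (@rV_cons R d) (@rV_uncons R d).
Proof.
by move=> [a x]; rewrite /rV_cons /rV_uncons /= row_mxKr row_mxEl mxE.
Qed.

Lemma measurable_rV_cons (R : realType) (d : nat) :
  measurable_fun [set: measurableTypeR R * 'rV[R]_d] (@rV_cons R d).
Proof.
apply: (@measurable_fun_rV R (1 + d)) => i; case: (split_ordP i) => j ->.
  rewrite (_ : _ \o _ = fst); first exact: measurable_fst.
  by apply/funext => p; rewrite /rV_coord /rV_cons /= row_mxEl mxE.
rewrite (_ : _ \o _ = rV_coord j \o snd).
  by apply: measurableT_comp; [exact: measurable_rV_coord|exact: measurable_snd].
by apply/funext => p; rewrite /rV_coord /rV_cons /= row_mxEr.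
Qed.

Lemma measurable_rV_uncons (R : realType) (d : nat) :
  measurable_fun [set: 'rV[R]_(1 + d)] (@rV_uncons R d).
Proof.
apply: measurable_fun_pair.
  exact: (@measurable_rV_coord R (1 + d)%N (lshift d ord0)).
apply: (@measurable_fun_rV R d) => i.
rewrite (_ : _ \o _ = rV_coord (rshift 1 i)); first exact: measurable_rV_coord.
by apply/funext => x; rewrite /rV_coord /= mxE.
Qed.

Section lebesgue_cons.
Variables (R : realType) (d : nat).
Variable m : {sigma_finite_measure set 'rV[R]_d -> \bar R}.
Local Open Scope ereal_scope.

Definition lebesgue_cons : set 'rV[R]_(1 + d) -> \bar R :=
  pushforward (@lebesgue_measure R \x m) (@rV_cons R d).

Let mpre A : measurable A -> measurable (@rV_cons R d @^-1` A).
Proof. by move=> mA; rewrite -[X in measurable X]setTI; exact: measurable_rV_cons. Qed.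

Let lebesgue_cons0 : lebesgue_cons set0 = 0.
Proof. by rewrite /lebesgue_cons /pushforward preimage_set0 measure0. Qed.

Let lebesgue_cons_ge0 A : 0 <= lebesgue_cons A.
Proof. by rewrite /lebesgue_cons /pushforward; exact: measure_ge0. Qed.

Let lebesgue_cons_sigma_additive : semi_sigma_additive lebesgue_cons.
Proof.
move=> F mF tF mUF; rewrite /lebesgue_cons /pushforward preimage_bigcup.
apply: measure_semi_sigma_additive.
- by move=> n; exact: mpre.
- apply/trivIsetP => /= i j _ _ ij; rewrite -preimage_setI.
  by move/trivIsetP : tF => /(_ _ _ _ _ ij) ->//; rewrite preimage_set0.
- by rewrite -preimage_bigcup; exact: mpre.
Qed.

HB.instance Definition _ := isMeasure.Build _ _ _ lebesgue_cons
  lebesgue_cons0 lebesgue_cons_ge0 lebesgue_cons_sigma_additive.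

Let lebesgue_cons_sigma_finite : sigma_finite setT lebesgue_cons.
Proof.
have /sigma_finiteP[F [TF ndF Foo]] := sigma_finiteT (@lebesgue_measure R).
have /sigma_finiteP[G [TG ndG Goo]] := sigma_finiteT m.
exists (fun n => @rV_uncons R d @^-1` (F n `*` G n)).
  apply/seteqP; split=> // x _.
  have [n _ Fn] : (\bigcup_n F n) (rV_uncons x).1 by rewrite -TF.
  have [k _ Gk] : (\bigcup_n G n) (rV_uncons x).2 by rewrite -TG.
  exists (maxn n k) => //; split.
    by move: Fn; exact/subsetPset/ndF/leq_maxl.
  by move: Gk; exact/subsetPset/ndG/leq_maxr.
move=> n; have [mF Fn] := Foo n; have [mG Gn] := Goo n; split.
  rewrite -[X in measurable X]setTI; apply: measurable_rV_uncons => //.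
  exact: measurableX.
rewrite /lebesgue_cons /pushforward -comp_preimage.
rewrite (_ : _ \o _ = id); last by apply/funext; exact: rV_consK.
by rewrite preimage_id product_measure1E// lte_mul_pinfty// ge0_fin_numE.
Qed.

HB.instance Definition _ := @Measure_isSigmaFinite.Build _ _ _ lebesgue_cons
  lebesgue_cons_sigma_finite.

End lebesgue_cons.

(* [lebesgue_rV 0] is the unit mass on the one-point space, and R^(1 + d)
   carries the product of the one-dimensional Lebesgue measure with
   [lebesgue_rV d]. *)
Fixpoint lebesgue_rV (R : realType) (d : nat) :
    {sigma_finite_measure set 'rV[R]_d -> \bar R} :=
  if d is d'.+1 then lebesgue_cons (lebesgue_rV R d') else \d_ (0 : 'rV[R]_0).

Lemma lebesgue_rV_box (R : realType) (d : nat) (I : 'I_d -> interval R) :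
  lebesgue_rV R d [set x | forall i, x ord0 i \in I i] =
  (\prod_(i < d) lebesgue_measure [set` I i])%E.
Proof.
elim: d I => [|d IH] I.
  by rewrite big_ord0 /= diracE mem_set//= => -[].
have lift0 (j : 'I_d) : lift ord0 j = rshift 1 j by exact/val_inj.
have ord0E : (ord0 : 'I_d.+1) = lshift d (ord0 : 'I_1) by exact/val_inj.
pose B := [set x : 'rV[R]_d | forall i, x ord0 i \in I (lift ord0 i)].
rewrite big_ord_recl -(IH (fun i => I (lift ord0 i))) -/B.
transitivity (lebesgue_cons (lebesgue_rV R d)
    (@rV_uncons R d @^-1` ([set` I ord0] `*` B))).
  congr (lebesgue_cons _ _); apply/seteqP; split=> x /=.
    move=> xI; split; first by have := xI ord0; rewrite ord0E.
    by move=> i; rewrite mxE lift0; exact: xI.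
  move=> [xI0 xB] i; case: (split_ordP (i : 'I_(1 + d))) => j ->.
    by move: xI0; rewrite /= ord0E (ord1 j).
  by rewrite -lift0; have := xB j; rewrite mxE lift0.
rewrite /lebesgue_cons /pushforward -comp_preimage.
rewrite (_ : @rV_uncons R d \o @rV_cons R d = id); last first.
  by apply/funext; exact: rV_consK.
rewrite preimage_id product_measure1E//.
rewrite (_ : B = \bigcap_(i in [set: 'I_d])
    (setT `&` rV_coord i @^-1` [set` I (lift ord0 i)])).
  apply: fin_bigcap_measurable => [|i _]; first exact: finite_finset.
  by apply: measurable_rV_coord => //; exact: measurable_itv.
apply/seteqP; split=> x xB i; first by split => //; exact: xB.
by have [] := xB i Logic.I.
Qed.

Definition is_bounded_domain (R : realType) (d : nat) (Om : set 'rV[R]_d) :=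
  [/\ open Om, connected Om, bounded_set Om & Om !=set0].

Definition boundary (R : realType) (d : nat) (Om : set 'rV[R]_d) :=
  closure Om `\` Om°.

Definition convex_hull (R : realType) (d : nat) (s : seq 'rV[R]_d) :
    set 'rV[R]_d :=
  [set x | exists a : 'I_(size s) -> R,
    [/\ forall i, 0 <= a i, \sum_i a i = 1 & x = \sum_i a i *: s`_i]].

(* A closed d-simplex is given by its d + 1 vertices. *)
Definition nondegenerate (R : realType) (d : nat) (K : d.+1.-tuple 'rV[R]_d) :=
  free [seq p - thead K | p <- behead K].

(* Any two simplices meet along the convex hull of their common vertices:
   a common face, or the empty set when there is no common vertex. *)
Definition is_triangulation (R : realType) (d : nat) (D : set 'rV[R]_d)
    (Th : seq (d.+1.-tuple 'rV[R]_d)) :=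
  [/\ forall K, K \in Th -> nondegenerate K,
      D = \bigcup_(K in [set` Th]) convex_hull K &
      forall K L, K \in Th -> L \in Th ->
        convex_hull K `&` convex_hull L =
        convex_hull [seq p <- K | p \in (L : seq _)]].

(* [mmeasure mdeg p] is the total degree of [p] plus one (and 0 if
   [p] is 0). *)
Definition polynomial_on (R : realType) (d j : nat) (K : set 'rV[R]_d)
    (f : 'rV[R]_d -> R) :=
  exists2 p : mpoly d R, (@mmeasure d R mdeg p <= j.+1)%N &
    forall x, K x -> f x = meval (fun i => x ord0 i) p.

(* Finite element functions are total functions whose values outside the closed
   domain (in space) or the closed slab (in time) are irrelevant. *)
Definition Ph (R : realType) (d : nat) (Om : set 'rV[R]_d)
    (Th : seq (d.+1.-tuple 'rV[R]_d)) (j : nat) : set ('rV[R]_d -> R) :=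
  [set f | {within closure Om, continuous f} /\
    forall K, K \in Th -> polynomial_on j (convex_hull K) f].

Definition Sh (R : realType) (d : nat) (Om : set 'rV[R]_d)
    (Th : seq (d.+1.-tuple 'rV[R]_d)) (a b : R) (j l : nat) :
    set ('rV[R]_d -> R -> R) :=
  [set f | exists2 phi : 'I_l.+1 -> 'rV[R]_d -> R,
    forall i, Ph Om Th j (phi i) &
    forall x s, closure Om x -> s \in `[a, b] ->
      f x s = \sum_(i < l.+1) phi i x * s ^+ i].

Definition Wh (R : realType) (d : nat) (Om Gu : set 'rV[R]_d)
    (Th : seq (d.+1.-tuple 'rV[R]_d)) (j : nat) :
    set ('rV[R]_d -> 'rV[R]_d) :=
  [set w | (forall k : 'I_d, Ph Om Th j (fun x => w x ord0 k)) /\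
    forall x, Gu x -> w x = 0].

Definition WhQ (R : realType) (d : nat) (Om Gu : set 'rV[R]_d)
    (Th : seq (d.+1.-tuple 'rV[R]_d)) (a b : R) (j l : nat) :
    set ('rV[R]_d -> R -> 'rV[R]_d) :=
  [set w | (forall k : 'I_d, Sh Om Th a b j l (fun x s => w x s ord0 k)) /\
    forall x s, Gu x -> s \in `[a, b] -> w x s = 0].

(* Dot product of vectors and double contraction of second-order tensors. *)
Definition contract (R : realType) (m n : nat) (A B : 'M[R]_(m, n)) : R :=
  \sum_i \sum_j A i j * B i j.

Definition l2 (R : realType) (d m n : nat) (Om : set 'rV[R]_d)
    (f g : 'rV[R]_d -> 'M[R]_(m, n)) : R :=
  \int[lebesgue_rV R d]_(x in Om) contract (f x) (g x).

Definition l2Q (R : realType) (d m n : nat) (Om : set 'rV[R]_d) (a b : R)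
    (f g : 'rV[R]_d -> R -> 'M[R]_(m, n)) : R :=
  \int[@lebesgue_measure R]_(s in `[a, b]) l2 Om (f^~ s) (g^~ s).

(* Finite element functions are differentiable in the interior of each element,
   so that the pointwise Jacobian below is their gradient off a null set. *)
Definition strain (R : realType) (d : nat) (u : 'rV[R]_d -> 'rV[R]_d)
    (x : 'rV[R]_d) : 'M[R]_d :=
  2^-1 *: ('J u x + ('J u x)^T).

Definition strainQ (R : realType) (d : nat) (u : 'rV[R]_d -> R -> 'rV[R]_d)
    (x : 'rV[R]_d) (s : R) : 'M[R]_d := strain (u^~ s) x.

Definition dotQ (R : realType) (d : nat) (u : 'rV[R]_d -> R -> 'rV[R]_d)
    (x : 'rV[R]_d) (s : R) : 'rV[R]_d := derive1 (u x) s.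

Definition right_trace (R : realType) (d : nat) (u : 'rV[R]_d -> R -> 'rV[R]_d)
    (a : R) (x : 'rV[R]_d) : 'rV[R]_d := lim (u x s @[s --> a^'+]).

Definition left_trace (R : realType) (d : nat) (u : 'rV[R]_d -> R -> 'rV[R]_d)
    (a : R) (x : 'rV[R]_d) : 'rV[R]_d := lim (u x s @[s --> a^'-]).

(* [u n] is the restriction of the discrete field to the n-th slab, so that its
   value at [(t n)^-] is that of the slab [n - 1], or the initial datum [u0]. *)
Definition minus_trace (R : realType) (d : nat) (t : nat -> R)
    (u0 : 'rV[R]_d -> 'rV[R]_d) (u : nat -> 'rV[R]_d -> R -> 'rV[R]_d)
    (n : nat) : 'rV[R]_d -> 'rV[R]_d :=
  if n is n'.+1 then left_trace (u n') (t n) else u0.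

Definition tensor4 (R : realType) (d : nat) := 'I_d -> 'I_d -> 'I_d -> 'I_d -> R.

Definition apply4 (R : realType) (d : nat) (C : tensor4 R d) (e : 'M[R]_d) :
    'M[R]_d := \matrix_(i, j) \sum_k \sum_l C i j k l * e k l.

Definition elasticity_symmetries (R : realType) (d : nat) (C : tensor4 R d) :=
  forall i j k l,
    [/\ C i j k l = C j i k l, C i j k l = C i j l k & C i j k l = C k l i j].

Definition positive_on_sym (R : realType) (d : nat) (C : tensor4 R d) :=
  forall e : 'M[R]_d, e^T = e -> e != 0 ->
    0 < \sum_i \sum_j \sum_k \sum_l C i j k l * e i j * e k l.

Definition thermal_tensor (R : realType) (d : nat) (omega kappa : R) : 'M[R]_d :=
  (3 * omega * kappa)%:M.

Definition adiabatic (R : realType) (d : nat) (C : tensor4 R d)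
    (c Theta0 : R) (m : 'M[R]_d) : tensor4 R d :=
  fun i j k l => C i j k l + Theta0 / c * (m i j * m k l).

Definition energyM (R : realType) (d : nat) (Om : set 'rV[R]_d)
    (Cad : tensor4 R d) (rho : R) (u v : 'rV[R]_d -> 'rV[R]_d) : R :=
  2^-1 * \int[lebesgue_rV R d]_(x in Om)
    (contract (strain u x) (apply4 Cad (strain u x)) +
     rho * contract (v x) (v x)).

Definition is_time_partition (R : realType) (T : R) (N : nat) (t : nat -> R) :=
  [/\ t 0 = 0, t N = T & forall n, (n < N)%N -> t n < t n.+1].

(* The weak form on the slab over [[a, b]], with [um], [vm] the values at a^-
   and homogeneous data. *)
Definition slab_equation (R : realType) (d : nat) (Om : set 'rV[R]_d) (a b : R)
    (Cad : tensor4 R d) (rho : R)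
    (um vm : 'rV[R]_d -> 'rV[R]_d) (u v w phi : 'rV[R]_d -> R -> 'rV[R]_d) :=
  l2Q Om a b (dotQ u) w - l2Q Om a b v w
  + l2Q Om a b (fun x s => rho *: dotQ v x s) phi
  + l2Q Om a b (fun x s => apply4 Cad (strainQ u x s)) (strainQ phi)
  + l2 Om (right_trace u a) (right_trace w a)
  + l2 Om (fun x => rho *: right_trace v a x) (right_trace phi a)
  = l2 Om um (right_trace w a)
  + l2 Om (fun x => rho *: vm x) (right_trace phi a).

Definition mechanical_scheme (R : realType) (d : nat) (Om Gu : set 'rV[R]_d)
    (Th : seq (d.+1.-tuple 'rV[R]_d)) (j l N : nat) (t : nat -> R)
    (Cad : tensor4 R d) (rho : R) (u0 v0 : 'rV[R]_d -> 'rV[R]_d)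
    (u v : nat -> 'rV[R]_d -> R -> 'rV[R]_d) :=
  forall n, (n < N)%N ->
    [/\ WhQ Om Gu Th (t n) (t n.+1) j l (u n),
        WhQ Om Gu Th (t n) (t n.+1) j l (v n) &
        forall w phi,
          WhQ Om Gu Th (t n) (t n.+1) j l w ->
          WhQ Om Gu Th (t n) (t n.+1) j l phi ->
          slab_equation Om (t n) (t n.+1) Cad rho
            (minus_trace t u0 u n) (minus_trace t v0 v n) (u n) (v n) w phi].

(* Main.v *)
Require Import Defs.
From HB Require Import structures.
From mathcomp Require Import all_boot all_order all_algebra.
From mathcomp Require Import -(notations) mpoly.
From mathcomp Require Import all_classical all_reals all_analysis.
From mathcomp Require Import measurable_realfun ring lra.

Set Implicit Arguments.
Unset Strict Implicit.
Unset Printing Implicit Defensive.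

Import Order.TTheory GRing.Theory Num.Theory numFieldNormedType.Exports.

Local Open Scope classical_set_scope.
Local Open Scope ring_scope.

(** Formally one tests the first equation with the elasticity operator applied
to the displacement [u] and the second with the velocity [v].  The scheme only
allows finite element test functions, so the operator is replaced by its
discrete representative: a [w] in the same space with [<g, w> = a(g, u)] for the
finitely many [g] that occur, where [a] is the elastic form
([representation]).  Such a [w] exists by linear algebra on a Gram matrix,
provided that [a(f, .)] vanishes whenever [f] has zero L2 norm.  This holds
because such an [f] vanishes on an open set of full measure, hence so does its
strain ([l2_null_elastic]).

With [(w, v)] as test functions the coupling terms [-(v, w)] and [a(u, v)]
cancel, the remaining time integrals are those of the derivatives of
[a(u, u) / 2] and [rho <v, v> / 2], which are polynomials in time, and the jump
terms combine to
[E(end) + (a([u], [u]) + rho <[v], [v]>) / 2 = E(start)],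
where [[u]] and [[v]] denote the jumps at the beginning of the slab; this holds
for every length of the time step ([slab_energy], [energy_balance]).  The form
[a] is nonnegative because the adiabatic correction is a square
([adiabatic_ge0]).

The analytic part justifies the bilinearity of [a].  The strain is a
pointwise Jacobian, which means nothing on the faces of the elements, so that
the integrands need not be measurable there.  The faces lie in finitely many
hyperplanes, which are null sets, and dropping a null set never changes an
integral, even that of a nonmeasurable function ([integral_off_null]).  On the
rest of the domain, the open set [element_interiors], finite element functions
have bounded continuous first derivatives ([Wh_bounded_C1]), and the forms
become integrals of bounded continuous functions over a bounded open set. *)

Local Notation contract := Defs.contract.

(** * Integrals and null sets *)

Section integral_off_null_set.
Context d (T : measurableType d) (R : realType).
Variables (mu : {measure set T -> \bar R}) (D E N : set T).
Hypotheses (DE : D `<=` E) (EDN : E `\` D `<=` N).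
Hypotheses (mN : measurable N) (N0 : mu N = 0%E).

Import HBNNSimple.

(** The integral of a nonnegative function is the supremum over the simple
functions below it.  Setting such a simple function to zero on the null set does
not change its integral, so the supremum is the same even when [f] is not
measurable. *)
Lemma ge0_integral_off_null (f : T -> \bar R) : (forall x, 0 <= f x)%E ->
  (\int[mu]_(x in E) f x = \int[mu]_(x in D) f x)%E.
Proof.
move=> f0; rewrite !ge0_integralE//; apply/eqP; rewrite eq_le; apply/andP; split.
  apply: ge_ereal_sup => _ [h /= hf <-].
  pose g := proj_nnsfun h (measurableC mN).
  have gE x : g x = h x * \1_(~` N) x by [].
  have -> : sintegral mu h = sintegral mu g.
    have sE (k : {nnsfun T >-> R}) : sintegral mu k = (\int[mu]_x (k x)%:E)%E.
      by rewrite integral_nnsfun// patch_setT.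
    rewrite !sE.
    apply: ae_eq_integral => //.
    - by apply/measurable_EFinP; exact: measurable_funP.
    - by apply/measurable_EFinP; exact: measurable_funP.
    exists N; split => // x /= /not_implyP[_ hg]; apply: contrapT => Nx.
    have gh : g x = h x by rewrite gE indicE mem_set// mulr1.
    exact/hg/(congr1 EFin)/esym.
  suff gf x : ((g x)%:E <= (f \_ D) x)%E by apply: ereal_sup_ubound; exists g.
  rewrite gE indicE.
  have [xN|xN] := boolP (x \in ~` N); last first.
    by rewrite mulr0 erestrict_ge0.
  rewrite mulr1; apply: le_trans (hf x) _; rewrite !patchE.
  case: ifPn => // xE; last by case: ifP.
  case: ifPn => // xD; exfalso; move: xN; rewrite inE; apply.
  by apply: EDN; split; [exact: set_mem|move/mem_set; apply/negP].
apply: ge_ereal_sup => _ [h /= hf <-]; apply: ereal_sup_ubound; exists h => //= x.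
apply: le_trans (hf x) _; rewrite !patchE; case: ifPn => xD; last by case: ifP.
by rewrite (mem_set (DE (set_mem xD))).
Qed.

Lemma integral_off_null (f : T -> \bar R) :
  (\int[mu]_(x in E) f x = \int[mu]_(x in D) f x)%E.
Proof.
by rewrite integralE [RHS]integralE; congr (_ - _)%E; exact: ge0_integral_off_null.
Qed.

Lemma eq_Rintegral_off_null (f g : T -> R) : {in D, f =1 g} ->
  \int[mu]_(x in E) f x = \int[mu]_(x in E) g x.
Proof.
move=> fg; rewrite /Rintegral !integral_off_null; congr fine.
by apply: eq_integral => x xD; rewrite fg.
Qed.

End integral_off_null_set.

Section lebesgue_rV_theory.
Variable R : realType.

Lemma measurable_box d (I : 'I_d -> interval R) :
  measurable [set x : 'rV[R]_d | forall i, x ord0 i \in I i].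
Proof.
rewrite (_ : [set _ | _] = \bigcap_(i in [set: 'I_d])
    (setT `&` rV_coord i @^-1` [set` I i])).
  apply: fin_bigcap_measurable => [|i _]; first exact: finite_finset.
  by apply: measurable_rV_coord => //; exact: measurable_itv.
apply/seteqP; split=> x xB i; first by split => //; exact: xB.
by have [] := xB i Logic.I.
Qed.

Lemma rV_ballE d (x : 'rV[R]_d) (e : R) : 0 < e ->
  ball x e = [set y | forall i, y ord0 i \in `]x ord0 i - e, x ord0 i + e[].
Proof.
move=> e0; apply/seteqP; split => y.
  by move=> [_ xy] i; have := xy ord0 i; rewrite ball_itv.
by move=> xy; split => // i j; rewrite (ord1 i) ball_itv; exact: xy.
Qed.

(** The sigma-algebra is generated by the coordinates; an open set is the union
of the balls with rational center and radius [1 / n] that it contains. *)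
Lemma open_measurable_rV d (A : set 'rV[R]_d) : open A -> measurable A.
Proof.
move=> oA.
pose B (p : {ffun 'I_d -> rat} * nat) : set 'rV[R]_d :=
  let b := ball (\row_i ratr (p.1 i) : 'rV[R]_d) p.2.+1%:R^-1 in
  if `[< b `<=` A >] then b else set0.
have -> : A = \bigcup_p B p.
  apply/seteqP; split => [x Ax|x [p _]]; last first.
    by rewrite /B; case: asboolP => // bA xb; exact: bA.
  have /nbhs_ballP[e /= e0 eA] : nbhs x A by apply: open_nbhs_nbhs.
  pose n := Num.truncn (2 / e).
  have ne : n.+1%:R^-1 < e / 2.
    rewrite invf_plt ?posrE ?divr_gt0// invf_div.
    exact: Num.Theory.truncnS_gt.
  have n0 : 0 < n.+1%:R^-1 :> R by [].
  have q_ex i : exists q : rat, ratr q \in `]x ord0 i - n.+1%:R^-1, x ord0 i + n.+1%:R^-1[.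
    have [|q] := @rat_in_itvoo R (x ord0 i - n.+1%:R^-1) (x ord0 i + n.+1%:R^-1).
      by rewrite ltrBlDr -addrA ltrDl addr_gt0.
    by exists q.
  have [q Hq] := choice q_ex.
  pose p := ([ffun i => q i], n).
  have bx : ball (\row_i ratr (p.1 i) : 'rV[R]_d) n.+1%:R^-1 x.
    apply: ball_sym; rewrite rV_ballE// => i; rewrite mxE ffunE; exact: Hq.
  exists p => //; rewrite /B; case: asboolP => //= bA; exfalso; apply: bA.
  move=> y yb; apply: eA; rewrite [e]splitr.
  by apply: ball_triangle; [apply: ball_sym; apply: le_ball bx|apply: le_ball yb]; exact: ltW.
apply: countable_bigcupT_measurable => [|p]; first exact: countableP.
rewrite /B; case: asboolP => // _; rewrite rV_ballE//; exact: measurable_box.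
Qed.

Lemma lebesgue_rV_ball_gt0 d (x : 'rV[R]_d) (e : R) : 0 < e ->
  (0 < lebesgue_rV R d (ball x e))%E.
Proof.
move=> e0; rewrite rV_ballE//.
rewrite (lebesgue_rV_box (fun i => `]x ord0 i - e, x ord0 i + e[)).
apply: (big_ind (fun r => 0 < r)%E) => [|a b|i _]; first by rewrite lte01.
  exact: mule_gt0.
rewrite lebesgue_measure_itv /= lte_fin ifT ?lte_fin ?subr_gt0.
  by lra.
by lra.
Qed.

Lemma lebesgue_rV_bounded d (A : set 'rV[R]_d) : measurable A ->
  bounded_set A -> (lebesgue_rV R d A < +oo)%E.
Proof.
move=> mA [M [_ AM]]; pose r := M + 1.
pose I (i : 'I_d) : interval R := `[- r, r].
apply: (@le_lt_trans _ _ (lebesgue_rV R d [set x | forall i, x ord0 i \in I i])).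
  apply: le_measure; rewrite ?inE//; first exact: measurable_box.
  move=> x /(AM r) + i; rewrite ltrDl ltr01 => /(_ isT) xr.
  rewrite in_itv /= -ler_norml; apply: le_trans xr.
  rewrite [leRHS]/Num.norm /= mx_normrE.
  by apply/bigmax_geP; right => /=; exists (ord0, i).
rewrite lebesgue_rV_box; rewrite ltey_eq; apply/orP; left.
apply: (big_ind (fun r : \bar R => r \is a fin_num)) => // [a b|i _].
  exact: fin_numM.
by rewrite lebesgue_measure_itv /=; case: ifP.
Qed.

(** By induction on the dimension, slicing along the first coordinate: if some
other coefficient is nonzero then every slice is a hyperplane of the smaller
space, and otherwise the hyperplane is a point times the smaller space. *)
Lemma lebesgue_rV_hyperplane d (c : 'I_d -> R) (b : R) (i : 'I_d) : c i != 0 ->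
  let H := [set x : 'rV[R]_d | \sum_k x ord0 k * c k = b] in
  measurable H /\ lebesgue_rV R d H = 0%E.
Proof.
move=> ci H.
have mHy d' (c' : 'I_d' -> R) (b' : R) :
    measurable [set x : 'rV[R]_d' | \sum_k x ord0 k * c' k = b'].
  have mf : measurable_fun [set: 'rV[R]_d']
      ((fun x => \sum_k x ord0 k * c' k) : _ -> measurableTypeR R).
    apply: measurable_sum => k; apply: measurable_funM => //.
    exact: measurable_rV_coord.
  by have := mf measurableT [set b'] (measurable_set1 _); rewrite setTI.
split; first exact: mHy.
rewrite {}/H; elim: d c b i ci => [|d IH] c b i ci; first by case: i {ci}.
have ord0E : (ord0 : 'I_d.+1) = lshift d (ord0 : 'I_1) by exact/val_inj.
have lift0 (j : 'I_d) : lift ord0 j = rshift 1 j by exact/val_inj.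
pose H' (a : R) := [set x : 'rV[R]_d |
  \sum_k x ord0 k * c (lift ord0 k) = b - a * c ord0].
pose P : set (measurableTypeR R * 'rV[R]_d) := [set p | H' p.1 p.2].
have cons0 a (x : 'rV[R]_d) : (rV_cons (a, x) : 'rV[R]_d.+1) ord0 ord0 = a.
  transitivity (rV_cons (a, x) ord0 (lshift d ord0)).
    by rewrite -ord0E.
  by rewrite /rV_cons row_mxEl mxE.
have consS a (x : 'rV[R]_d) k :
    (rV_cons (a, x) : 'rV[R]_d.+1) ord0 (lift ord0 k) = x ord0 k.
  transitivity (rV_cons (a, x) ord0 (rshift 1 k)); first by rewrite -lift0.
  by rewrite /rV_cons row_mxEr.
have consE a (x : 'rV[R]_d) : \sum_k (rV_cons (a, x) : 'rV[R]_d.+1) ord0 k * c k =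
    a * c ord0 + \sum_k x ord0 k * c (lift ord0 k).
  by rewrite big_ord_recl cons0; under eq_bigr do rewrite consS.
have -> : lebesgue_rV R d.+1 [set x : 'rV[R]_d.+1 | \sum_k x ord0 k * c k = b] =
    (@lebesgue_measure R \x lebesgue_rV R d)%E P.
  rewrite /= /lebesgue_cons /pushforward; congr (product_measure1 _ _ _).
  apply/seteqP; split => [[a x]|[a x]]; rewrite /P /H' /= consE.
    by move=> <-; rewrite addrAC subrr add0r.
  by move=> ->; rewrite addrC subrK.
have [[j cj]|c0] := pselect (exists j, c (lift ord0 j) != 0).
  rewrite /product_measure1; apply: integral0_eq => a _ /=.
  rewrite (_ : xsection P a = H' a); first exact: IH cj.
  by apply/seteqP; split => x; rewrite /xsection /= inE.
have {}c0 j : c (lift ord0 j) = 0.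
  by apply/eqP/negPn/negP => cj; apply: c0; exists j.
have c00 : c ord0 != 0 by move: ci; case: (unliftP ord0 i) => [j|] ->; rewrite ?c0 ?eqxx.
have -> : P = [set b / c ord0] `*` [set: 'rV[R]_d].
  apply/seteqP; split => [[a x]|[a x]]; rewrite /P /H' /= big1.
  - by move=> /esym/subr0_eq ->; rewrite mulfK.
  - by move=> k _; rewrite c0 mulr0.
  - by move=> [-> _]; rewrite divfK// subrr.
  - by move=> k _; rewrite c0 mulr0.
by rewrite product_measure1E// [X in (X * _)%E]lebesgue_measure_set1 mul0e.
Qed.

End lebesgue_rV_theory.

(** * Simplices have null boundary *)

Lemma continuous_at_sum (R : realType) (T : topologicalType) n (F : 'I_n -> T -> R) x :
  (forall i, {for x, continuous (F i)}) ->
  {for x, continuous (fun y => \sum_i F i y)}.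
Proof. by move=> cF; apply: (cvg_big add_continuous) => i _; exact: cF. Qed.

Section triangulation.
Variables (R : realType) (d : nat).
Local Notation mu := (lebesgue_rV R d).

Lemma negligible_bigcup_seq (I : eqType) (s : seq I) (F : I -> set 'rV[R]_d) :
  (forall i, i \in s -> mu.-negligible (F i)) ->
  mu.-negligible (\bigcup_(i in [set` s]) F i).
Proof.
elim: s => [|i s IH] Fs.
  by apply: (negligibleS _ (negligible_set0 _)) => x [].
apply: negligibleS (negligibleU (Fs i (mem_head i s)) (IH _)).
  move=> x [k /= + Fk]; rewrite inE => /orP[/eqP <-|ks]; first by left.
  by right; exists k.
by move=> k ks; apply: Fs; rewrite inE ks orbT.
Qed.

Lemma negligible_hyperplane (c : 'I_d -> R) (b : R) :
  (exists i, c i != 0) ->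
  mu.-negligible [set x : 'rV[R]_d | \sum_k x ord0 k * c k = b].
Proof.
move=> [i ci]; have [mH H0] := lebesgue_rV_hyperplane b ci.
by apply/negligibleP.
Qed.

Lemma convex_hull_size (s : seq 'rV[R]_d) n x : size s = n ->
  convex_hull s x <-> exists a : 'I_n -> R,
    [/\ forall i, 0 <= a i, \sum_i a i = 1 & x = \sum_i a i *: s`_i].
Proof. by case: n /. Qed.

(** In the barycentric coordinates [lam], which are affine because the edge
vectors form an invertible matrix [P], the simplex is given by [0 <= lam i] and
[\sum_i lam i <= 1].  The strict inequalities define an open subset, and each of
the equalities defines a hyperplane. *)
Lemma simplex_boundary_negligible (K : d.+1.-tuple 'rV[R]_d) :
  Defs.nondegenerate K -> mu.-negligible (convex_hull K `\` (convex_hull K)°).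
Proof.
move=> ndK; pose p (i : 'I_d.+1) := (tval K)`_i.
pose P : 'M[R]_d := \matrix_i (p (lift ord0 i) - p ord0).
have rowP_P i : row i P = p (lift ord0 i) - p ord0 by rewrite rowK.
have Pu : P \in unitmx.
  rewrite -row_free_unit; apply: inj_row_free => v vP.
  have /freeP fK : free [tuple of [seq q - thead K | q <- behead_tuple K]] by [].
  apply/rowP => i; rewrite mxE; apply: fK; rewrite -[RHS]vP mulmx_sum_row.
  apply: eq_bigr => k _; rewrite rowP_P /p /= (nth_map 0) ?size_behead ?size_tuple//.
  by rewrite nth_behead /thead (tnth_nth 0).
pose lam (x : 'rV[R]_d) : 'rV[R]_d := (x - p ord0) *m invmx P.
have lamE x i : lam x ord0 i =
    \sum_k x ord0 k * invmx P k i - (p ord0 *m invmx P) ord0 i.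
  by rewrite /lam mulmxBl !mxE.
have hullP x : convex_hull K x <->
    (forall i, 0 <= lam x ord0 i) /\ \sum_i lam x ord0 i <= 1.
  rewrite (convex_hull_size x (size_tuple K)).
  have lamP a : 1 - \sum_i a (lift ord0 i) = a ord0 ->
      x = \sum_i a i *: p i <-> forall i, lam x ord0 i = a (lift ord0 i).
    move=> a1.
    have -> : \sum_i a i *: p i = p ord0 + (\row_i a (lift ord0 i)) *m P.
      rewrite mulmx_sum_row big_ord_recl -a1 scalerBl scale1r -addrA; congr (_ + _).
      rewrite scaler_suml addrC -sumrB; apply: eq_bigr => i _.
      by rewrite mxE rowP_P scalerBr.
    split => [xE i|lamE'].
      by rewrite /lam xE [p ord0 + _]addrC addrK mulmxK// mxE.
    rewrite (_ : \row_i _ = lam x); last by apply/rowP => i; rewrite mxE lamE'.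
    by rewrite /lam mulmxKV// addrC subrK.
  split=> [[a [a0 a1 xE]]|[l0 l1]].
    have {}a1 : 1 - \sum_i a (lift ord0 i) = a ord0.
      by rewrite -a1 big_ord_recl addrK.
    have la := (lamP _ a1).1 xE; split=> [i|]; first by rewrite la.
    under eq_bigr do rewrite la.
    by rewrite -subr_ge0 a1.
  pose a i := if unlift ord0 i is Some j then lam x ord0 j
              else 1 - \sum_i lam x ord0 i.
  have a0 : a ord0 = 1 - \sum_i lam x ord0 i by rewrite /a unlift_none.
  have aS i : a (lift ord0 i) = lam x ord0 i by rewrite /a liftK.
  exists a; split.
  - move=> i; case: (unliftP ord0 i) => [j|] ->; first by rewrite aS.
    by rewrite a0 subr_ge0.
  - by rewrite big_ord_recl a0; under [X in _ + X]eq_bigr do rewrite aS; rewrite subrK.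
  - by apply/lamP => //; rewrite a0; under eq_bigr do rewrite aS.
pose U := [set x | (forall i, 0 < lam x ord0 i) /\
  \sum_i lam x ord0 i < 1].
have clam i : continuous (fun x => lam x ord0 i).
  move=> x; rewrite (_ : (fun x => _) = fun x : 'rV[R]_d => \sum_k x ord0 k * invmx P k i
    - (p ord0 *m invmx P) ord0 i); last by apply/funext => y; rewrite lamE.
  apply: (@continuousB _ R^o); last exact: cst_continuous.
  apply: continuous_at_sum => k; apply: continuousM; last exact: cst_continuous.
  exact: coord_continuous.
have UK : U `<=` (convex_hull K)°.
  rewrite -open_subsetE.
    by move=> x [x0 x1]; apply/hullP; split=> [i|]; exact: ltW.
  rewrite openE => x [x0 x1]; have near_lam : \forall y \near x, forall i, 0 < lam y ord0 i.
    refine (@filter_forall _ _ (fun i => [set y | 0 < lam y ord0 i]) (nbhs x) _ _) => i.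
    exact: (clam i x _ (lt_nbhsr (x0 i))).
  have near_sum : \forall y \near x, \sum_i lam y ord0 i < 1.
    have cs : {for x, continuous (fun y => \sum_i lam y ord0 i)}.
      by apply: continuous_at_sum => i; exact: clam.
    exact: (cs _ (lt_nbhsl x1)).
  exact: filterI near_lam near_sum.
pose F i := [set x | lam x ord0 i = 0].
pose G := [set x | \sum_i lam x ord0 i = 1].
suff [nF nG] : (forall i, mu.-negligible (F i)) /\ mu.-negligible G.
  apply: negligibleS (negligibleU nG
    (@negligible_bigcup_seq _ (enum 'I_d) F (fun i _ => nF i))).
  move=> x [/hullP[x0 x1] xK]; have [s1|s1] := eqVneq (\sum_i lam x ord0 i) 1.
    by left.
  right; apply: contrapT => nFx; apply/xK/UK; split; last first.
    by rewrite lt_neqAle s1.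
  move=> i; rewrite lt_neqAle x0 andbT eq_sym; apply/negP => /eqP xi.
  by apply: nFx; exists i => //=; rewrite mem_enum.
split=> [i|].
  have -> : F i = [set x | \sum_k x ord0 k * invmx P k i =
                         (p ord0 *m invmx P) ord0 i].
    by apply/seteqP; split => x; rewrite /F /= lamE; [move/subr0_eq|move->; rewrite subrr].
  apply: negligible_hyperplane; apply: contrapT => /forallNP ci.
  have := congr1 (fun A : 'M[R]_d => A i i) (mulmxV Pu).
  rewrite !mxE eqxx big1 => [/eqP|k _]; first by rewrite eq_sym oner_eq0.
  by have /negP/negPn/eqP -> := ci k; rewrite mulr0.
have [k0 _|d0] := pickP (fun k : 'I_d => true); last first.
  apply: (negligibleS _ (negligible_set0 _)) => x; rewrite /G /=.
  rewrite big1 => [/esym/eqP|k]; first by rewrite oner_eq0.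
  by have := d0 k.
have -> : G = [set x | \sum_k x ord0 k * (\sum_i invmx P k i) =
                       1 + \sum_i (p ord0 *m invmx P) ord0 i].
  have GE x : \sum_i lam x ord0 i = \sum_k x ord0 k * (\sum_i invmx P k i) -
      \sum_i (p ord0 *m invmx P) ord0 i.
    under eq_bigr do rewrite lamE.
    rewrite sumrB; congr (_ - _); rewrite exchange_big.
    by apply: eq_bigr => k _; rewrite mulr_sumr.
  apply/seteqP; split => x; rewrite /G /= GE; first by move=> <-; rewrite subrK.
  by move=> ->; rewrite addrK.
apply: negligible_hyperplane; apply: contrapT => /forallNP ci.
have /matrixP/(_ k0 ord0) : P *m (invmx P *m const_mx 1) = const_mx 1 :> 'cV[R]_d.
  by rewrite mulKVmx.
rewrite !mxE big1 => [/esym/eqP|k _]; first by rewrite oner_eq0.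
have /negP/negPn/eqP ck := ci k.
rewrite [X in _ * X]mxE; under [X in _ * X]eq_bigr do rewrite mxE mulr1.
by rewrite ck mulr0.
Qed.

End triangulation.

(** * Continuously differentiable functions *)

Section differential.
Variables (R : realType) (V W : normedModType R).

Lemma near_is_diff (f g df : V -> W) (x : V) :
  {near x, f =1 g} -> is_diff x g df -> is_diff x f df.
Proof.
move=> fg [dg dgE].
have fE : f \o shift x = cst (f x) + 'd g x +o_ 0 id.
  apply/eqaddoP => e e0; rewrite (nbhs_singleton fg).
  have /eqaddoP/(_ e e0) small := diff_locally dg.
  move: fg; rewrite (near_shift 0 x) subr0 => fg.
  by apply: filterS2 fg small => y /= fgy; rewrite !fctE /= fgy.
have dfE := diff_unique (diff_continuous dg) fE.
split; last by rewrite dfE.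
apply/diff_locallyP; rewrite dfE; split => //.
exact: diff_continuous.
Qed.

Definition C1 (f : V -> R) :=
  (forall x, differentiable f x) /\ forall v, continuous (fun x => 'd f x v).

Lemma C1_continuous f : C1 f -> continuous f.
Proof. by move=> [df _] x; exact: differentiable_continuous. Qed.

Lemma C1_cst (a : R) : C1 (cst a).
Proof.
split=> [x|v]; first exact: differentiable_cst.
by under [X in continuous X]funext do rewrite diff_cst; exact: cst_continuous.
Qed.

Lemma C1D f g : C1 f -> C1 g -> C1 (f \+ g).
Proof.
move=> [df cf] [dg cg]; split=> [x|v]; first exact: differentiableD.
under [X in continuous X]funext do rewrite diffD//.
by move=> x; apply: (cvgD (cf v x) (cg v x)).
Qed.

Lemma C1M f g : C1 f -> C1 g -> C1 (f \* g).
Proof.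
move=> Cf Cg; have [[df cf] [dg cg]] := (Cf, Cg).
split=> [x|v]; first exact: differentiableM.
under [X in continuous X]funext do rewrite diffM//.
move=> x; apply: cvgD; apply: cvgM.
- exact: C1_continuous.
- exact: cg.
- exact: C1_continuous.
- exact: cf.
Qed.

Lemma C1_sum (I : Type) (s : seq I) (F : I -> V -> R) :
  (forall i, C1 (F i)) -> C1 (fun x => \sum_(i <- s) F i x).
Proof.
move=> CF; elim: s => [|i s IH].
  rewrite (_ : (fun x => _) = cst 0); first exact: C1_cst.
  by apply/funext => x; rewrite big_nil.
rewrite (_ : (fun x => _) = F i \+ (fun x => \sum_(k <- s) F k x)).
  exact: C1D (CF i) IH.
by apply/funext => x; rewrite big_cons.
Qed.

Lemma C1_prod (I : Type) (s : seq I) (F : I -> V -> R) :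
  (forall i, C1 (F i)) -> C1 (fun x => \prod_(i <- s) F i x).
Proof.
move=> CF; elim: s => [|i s IH].
  rewrite (_ : (fun x => _) = cst 1); first exact: C1_cst.
  by apply/funext => x; rewrite big_nil.
rewrite (_ : (fun x => _) = F i \* (fun x => \prod_(k <- s) F k x)).
  exact: C1M (CF i) IH.
by apply/funext => x; rewrite big_cons.
Qed.

Lemma C1X f n : C1 f -> C1 (fun x => f x ^+ n).
Proof.
move=> Cf; elim: n => [|n IH].
  by under [X in C1 X]funext do rewrite expr0; exact: C1_cst.
by under [X in C1 X]funext do rewrite exprS; exact: C1M.
Qed.

End differential.

Section polynomial_functions.
Variables (R : realType) (d : nat).

Lemma is_diff_coord n (x : 'rV[R]_n) (i : 'I_n) :
  is_diff x (fun y : 'rV[R]_n => y ord0 i) (fun y : 'rV[R]_n => y ord0 i).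
Proof.
have clin : linear (fun y : 'rV[R]_n => y ord0 i : R^o).
  by move=> a u v; rewrite !mxE.
pose cM := GRing.isLinear.Build _ _ _ _ _ clin.
pose cL : {linear 'rV[R]_n -> R^o} := HB.pack (fun y : 'rV[R]_n => y ord0 i : R^o) cM.
split; first exact: differentiable_coord.
by rewrite -[LHS]/('d cL x : 'rV[R]_n -> R^o) diff_lin//; exact: coord_continuous.
Qed.

Lemma C1_coord (i : 'I_d) : C1 (fun x : 'rV[R]_d => x ord0 i).
Proof.
split=> [x|v]; first exact: differentiable_coord.
have dE x : 'd (fun y : 'rV[R]_d => y ord0 i) x = (fun y => y ord0 i) :> (_ -> R).
  by case: (is_diff_coord x i).
by under [X in continuous X]funext do rewrite dE; exact: cst_continuous.
Qed.

(** Polynomials are sums of products of coordinates. *)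
Lemma C1_meval (p : mpoly d R) : C1 (fun x : 'rV[R]_d => meval (fun i => x ord0 i) p).
Proof.
under [X in C1 X]funext do rewrite mevalE.
apply: C1_sum => m; apply: C1M; first exact: C1_cst.
by apply: C1_prod => i; apply: C1X; exact: C1_coord.
Qed.

(** A bounded set is contained in a compact box. *)
Lemma continuous_bounded_on (A : set 'rV[R]_d) (g : 'rV[R]_d -> R) :
  bounded_set A -> continuous g -> exists M, forall x, A x -> `|g x| <= M.
Proof.
move=> [M [_ AM]] cg; pose r := M + 1.
pose B := [set x : 'rV[R]_d | forall i, `[- r, r]%classic (x ord0 i)].
have cB : compact B.
  by apply: (@rV_compact _ _ (fun=> `[- r, r]%classic)) => i; exact: segment_compact.
have : compact (g @` B).
  by apply: continuous_compact => //; exact: continuous_subspaceT.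
move=> /compact_bounded[M' [_ gM]]; exists (M' + 1) => x Ax.
apply: (gM (M' + 1)); first by rewrite ltrDl.
exists x => // i; rewrite /= in_itv /= -ler_norml.
apply: le_trans (AM r _ x Ax); last by rewrite ltrDl.
rewrite [leRHS]/Num.norm /= mx_normrE.
by apply/bigmax_geP; right => /=; exists (ord0, i).
Qed.

End polynomial_functions.

(** * Bounded continuous functions on an open set *)

Section bounded_continuous.
Variables (R : realType) (d : nat) (D : set 'rV[R]_d).

Definition bounded_cont (g : 'rV[R]_d -> R) :=
  (forall x, D x -> {for x, continuous g}) /\
  exists M, forall x, D x -> `|g x| <= M.

Lemma bounded_cont_cst a : bounded_cont (cst a).
Proof. by split=> [x _|]; [exact: cst_continuous|exists `|a|]. Qed.

Lemma bounded_contD f g : bounded_cont f -> bounded_cont g -> bounded_cont (f \+ g).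
Proof.
move=> [cf [M fM]] [cg [N gN]]; split=> [x Dx|].
  exact: cvgD (cf x Dx) (cg x Dx).
by exists (M + N) => x Dx; rewrite (le_trans (ler_normD _ _))// lerD ?fM ?gN.
Qed.

Lemma bounded_contM f g : bounded_cont f -> bounded_cont g -> bounded_cont (f \* g).
Proof.
move=> [cf [M fM]] [cg [N gN]]; split=> [x Dx|].
  exact: cvgM (cf x Dx) (cg x Dx).
by exists (M * N) => x Dx; rewrite normrM ler_pM ?fM ?gN.
Qed.

Lemma bounded_contZ a f : bounded_cont f -> bounded_cont (fun x => a * f x).
Proof. exact: bounded_contM (bounded_cont_cst a). Qed.

Lemma bounded_cont_sum (I : Type) (s : seq I) (F : I -> 'rV[R]_d -> R) :
  (forall i, bounded_cont (F i)) -> bounded_cont (fun x => \sum_(i <- s) F i x).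
Proof.
move=> bF; elim: s => [|i s IH].
  rewrite (_ : (fun x => _) = cst 0); first exact: bounded_cont_cst.
  by apply/funext => x; rewrite big_nil.
rewrite (_ : (fun x => _) = F i \+ (fun x => \sum_(k <- s) F k x)).
  exact: bounded_contD (bF i) IH.
by apply/funext => x; rewrite big_cons.
Qed.

Lemma near_eq_continuous_at (f g : 'rV[R]_d -> R) x :
  {near x, f =1 g} -> {for x, continuous g} -> {for x, continuous f}.
Proof.
move=> fg cg; rewrite /prop_for /continuous_at (nbhs_singleton fg).
apply: cvg_trans cg; apply: (@near_eq_cvg _ _ (nbhs x) _ g f).
by apply: filterS fg => y ->.
Qed.

Lemma eq_bounded_cont f g : open D -> (forall x, D x -> f x = g x) ->
  bounded_cont g -> bounded_cont f.
Proof.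
move=> oD fg [cg [M gM]]; split=> [x Dx|]; last first.
  by exists M => x Dx; rewrite fg ?gM.
apply: near_eq_continuous_at (cg x Dx).
have nD : \forall y \near x, D y by exact: open_nbhs_nbhs.
exact: filterS nD.
Qed.

Lemma bounded_cont_integrable g : open D -> bounded_set D -> bounded_cont g ->
  (lebesgue_rV R d).-integrable D (EFin \o g).
Proof.
move=> oD bD [cg [M gM]].
have mD := open_measurable_rV oD.
apply: measurable_bounded_integrable => //.
- exact: lebesgue_rV_bounded.
- apply: (measurability _ (RGenOInfty.measurableE R)) => _ [_ [a ->] <-].
  apply: open_measurable_rV; rewrite openE => x [Dx /=].
  rewrite in_itv /= andbT => ax.
  have nD : \forall y \near x, D y by exact: open_nbhs_nbhs.
  have ng : \forall y \near x, a < g y := cg x Dx _ (lt_nbhsr ax).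
  by apply: filterS2 nD ng => y Dy gy; split; rewrite //= in_itv /= gy.
- exists M; split; first exact: num_real.
  by move=> r Mr x Dx; exact: le_trans (gM x Dx) (ltW Mr).
Qed.

(** Where [g] is positive it exceeds a positive constant on a ball, and balls have
positive measure. *)
Lemma Rintegral_open_eq0 g : open D -> bounded_set D -> bounded_cont g ->
  \int[lebesgue_rV R d]_(x in D) (g x) = 0 -> (forall x, 0 <= g x) ->
  forall x, D x -> g x = 0.
Proof.
move=> oD bD bg ig0 g0 x Dx; apply/eqP/negPn/negP => gx0.
have mD := open_measurable_rV oD.
have gx : 0 < g x by rewrite lt_neqAle eq_sym gx0 g0.
have ing := bounded_cont_integrable oD bD bg.
have [e /= e0 eg] : nbhs_ball x (D `&` [set y | g x / 2 < g y]).
  apply/nbhs_ballP.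
  have gx2 : g x / 2 < g x by rewrite ltr_pdivrMr// ltr_pMr// ltr1n.
  have nD : \forall y \near x, D y by exact: open_nbhs_nbhs.
  have ng : \forall y \near x, g x / 2 < g y := bg.1 x Dx _ (lt_nbhsr gx2).
  exact: filterI nD ng.
have mB : measurable (ball x e) by apply: open_measurable_rV; exact: ball_open.
have : (0 < \int[lebesgue_rV R d]_(y in ball x e) (g x / 2)%:E)%E.
  rewrite integral_cst//; apply: mule_gt0; first by rewrite lte_fin divr_gt0.
  exact: lebesgue_rV_ball_gt0.
apply/negP; rewrite -leNgt.
have -> : 0%E = (\int[lebesgue_rV R d]_(y in D) (g y)%:E)%E.
  by rewrite -[RHS]fineK ?integrable_fin_num//; congr EFin; rewrite -ig0.
apply: (@le_trans _ _ (\int[lebesgue_rV R d]_(y in ball x e) (g y)%:E)%E).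
  apply: ge0_le_integral => //.
  - by move=> y _; rewrite lee_fin divr_ge0// ltW.
  - by apply: (measurable_funS mD _ (measurable_int _ ing)) => y /eg[].
  - by move=> y /eg[_ /= /ltW].
apply: ge0_subset_integral => //; last by move=> y /eg[].
  exact: measurable_int ing.
by move=> y _; rewrite lee_fin.
Qed.

End bounded_continuous.

(** * Jacobians of finite element functions *)

Section differentiable_fields.
Variables (R : realType) (d : nat).
Implicit Types (u v : 'rV[R]_d -> 'rV[R]_d) (D : set 'rV[R]_d).

(** The derivatives are taken coordinatewise; [jacobian_coord] relates them to the
Jacobian matrix. *)
Definition bounded_C1 D u := forall k : 'I_d,
  [/\ bounded_cont D (fun x => u x ord0 k),
      forall x, D x -> differentiable (fun y => u y ord0 k) x &
      forall h, bounded_cont D (fun x => 'd (fun y => u y ord0 k) x h)].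

Lemma bounded_C1_differentiable D u x : bounded_C1 D u -> D x -> differentiable u x.
Proof.
move=> ru Dx.
have -> : u = \sum_k (fun y => u y ord0 k *: delta_mx 0 k).
  by apply/funext => y; rewrite fct_sumE [LHS]row_sum_delta.
apply: differentiable_sum => k; apply: differentiableZl.
by have [_ + _] := ru k; apply.
Qed.

Lemma jacobian_coord D u x i k : bounded_C1 D u -> D x ->
  'J u x i k = 'd (fun y => u y ord0 k) x (delta_mx 0 i).
Proof.
move=> ru Dx; have du := bounded_C1_differentiable ru Dx.
have := is_diff_comp (differentiableP du) (is_diff_coord (u x) k).
by move=> [_ /funeqP/(_ (delta_mx 0 i)) /= E]; rewrite /jacobian mxE; exact: esym E.
Qed.

Lemma jacobian_lin D u v x a : bounded_C1 D u -> bounded_C1 D v -> D x ->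
  'J (a *: u + v) x = a *: 'J u x + 'J v x.
Proof.
move=> ru rv Dx; have du := bounded_C1_differentiable ru Dx.
have dv := bounded_C1_differentiable rv Dx.
have := is_diffD (is_diffZ a (differentiableP du)) (differentiableP dv).
move=> [_ /funeqP dE]; apply/matrixP => i k.
have JE (f : 'rV[R]_d -> 'rV[R]_d) : 'J f x i k = 'd f x (delta_mx 0 i) ord0 k.
  by rewrite /jacobian mxE.
transitivity ('d (a *: u + v) x (delta_mx 0 i) ord0 k); first exact: JE.
transitivity ((a *: 'd u x (delta_mx 0 i) + 'd v x (delta_mx 0 i)) ord0 k).
  exact: (congr1 (fun z : 'rV[R]_d => z ord0 k) (dE (delta_mx 0 i))).
rewrite [LHS]mxE [RHS]mxE.
rewrite [X in X + _ = _]mxE [X in _ = X + _]mxE.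
exact: (esym (congr2 (fun s t => a * s + t) (JE u) (JE v))).
Qed.

Lemma bounded_C10 D : bounded_C1 D (0 : 'rV[R]_d -> 'rV[R]_d).
Proof.
move=> k; have -> : (fun x => (0 : 'rV[R]_d -> 'rV[R]_d) x ord0 k) = cst (0 : R).
  by apply/funext => x; rewrite !fctE mxE.
split=> [|x _|h]; first exact: bounded_cont_cst.
  exact: differentiable_cst.
rewrite (_ : (fun x => _) = cst 0); first exact: bounded_cont_cst.
by apply/funext => x; rewrite diff_cst.
Qed.

Lemma strain_lin D u v x a : bounded_C1 D u -> bounded_C1 D v -> D x ->
  strain (a *: u + v) x = a *: strain u x + strain v x.
Proof.
move=> ru rv Dx; rewrite /strain (jacobian_lin a ru rv Dx).
by move: ('J u x) ('J v x) => A B; apply/matrixP => i k; rewrite !mxE; ring.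
Qed.

Lemma eq_strain D u v x : open D -> (forall y, D y -> u y = v y) ->
  bounded_C1 D v -> D x -> strain u x = strain v x.
Proof.
move=> oD uv rv Dx; have nD : \forall y \near x, D y by exact: open_nbhs_nbhs.
have nuv : {near x, u =1 v} by exact: filterS nD.
have [_ dE] := near_is_diff nuv (differentiableP (bounded_C1_differentiable rv Dx)).
have JE : 'J u x = 'J v x by exact: (congr1 (fun F => lin1_mx F) dE).
exact: (congr1 (fun A : 'M[R]_d => 2^-1 *: (A + A^T)) JE).
Qed.

Lemma bounded_cont_strain D u i k : open D -> bounded_C1 D u ->
  bounded_cont D (fun x => strain u x i k).
Proof.
move=> oD ru.
pose g x := 2^-1 * ('d (fun y => u y ord0 k) x (delta_mx 0 i) +
                    'd (fun y => u y ord0 i) x (delta_mx 0 k)).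
apply: (@eq_bounded_cont _ _ _ _ g) => //.
  move=> x Dx; transitivity (2^-1 * ('J u x i k + 'J u x k i)).
    by rewrite /strain; move: ('J u x) => A; rewrite !mxE.
  exact: (congr2 (fun s t => 2^-1 * (s + t)) (jacobian_coord i k ru Dx)
    (jacobian_coord k i ru Dx)).
apply: bounded_contZ; apply: bounded_contD.
  by have [_ _] := ru k; apply.
by have [_ _] := ru i; apply.
Qed.

End differentiable_fields.

Section elements.
Variables (R : realType) (d : nat) (Om : set 'rV[R]_d).
Variable Th : seq (d.+1.-tuple 'rV[R]_d).
Hypotheses (hOm : is_bounded_domain Om) (hTh : is_triangulation (closure Om) Th).
Local Notation mu := (lebesgue_rV R d).

(** The part of the domain on which every finite element function coincides, near
each point, with a polynomial. *)
Definition element_interiors : set 'rV[R]_d :=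
  Om `&` \bigcup_(K in [set` Th]) (convex_hull (K : d.+1.-tuple 'rV[R]_d))°.
Local Notation D := element_interiors.

Lemma open_element_interiors : open D.
Proof.
have [oOm _ _ _] := hOm; apply: openI => //.
by apply: bigcup_open => K _; exact: open_interior.
Qed.

Lemma bounded_element_interiors : bounded_set D.
Proof.
have [_ _ [M [Mr OmM]] _] := hOm; exists M; split => // r Mr' x [Omx _].
exact: OmM.
Qed.

Lemma element_interiors_sub : D `<=` Om. Proof. by move=> x []. Qed.

Lemma negligible_element_faces : mu.-negligible (Om `\` D).
Proof.
have [ndTh OmE _] := hTh.
pose F (K : d.+1.-tuple 'rV[R]_d) := convex_hull K `\` (convex_hull K)°.
apply: (@negligibleS _ _ _ _ (\bigcup_(K in [set` Th]) F K)).
  move=> x [Omx nDx].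
  have : closure Om x by exact: subset_closure.
  rewrite OmE => -[K KTh Kx]; exists K => //; split => // Kox.
  by apply: nDx; split => //; exists K.
by apply: negligible_bigcup_seq => K KTh; apply: simplex_boundary_negligible; exact: ndTh.
Qed.

(** This is what makes the values of the integrands on the element faces, where
the Jacobian may be meaningless, irrelevant. *)
Lemma eq_Rintegral_element_interiors (f g : 'rV[R]_d -> R) :
  (forall x, D x -> f x = g x) ->
  \int[mu]_(x in Om) f x = \int[mu]_(x in D) g x.
Proof.
move=> fg; have [N [mN N0 EDN]] := negligible_element_faces.
rewrite /Rintegral (integral_off_null element_interiors_sub EDN mN N0).
by congr fine; apply: eq_integral => x /set_mem Dx; rewrite fg.
Qed.

(** Both properties are inherited from the finitely many extensions [G], each of
which is bounded on the bounded domain. *)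
Lemma bounded_cont_piecewise (g : 'rV[R]_d -> R) :
  (forall K : d.+1.-tuple 'rV[R]_d, K \in Th -> exists2 G, continuous G &
     forall x, (convex_hull K)° x -> g x = G x) ->
  bounded_cont D g.
Proof.
move=> gP; split=> [x [_ [K KTh Kx]]|].
  have [G cG gG] := gP K KTh.
  apply: near_eq_continuous_at (cG x).
  have nK : \forall y \near x, (convex_hull K)° y.
    by apply: open_nbhs_nbhs; split => //; exact: open_interior.
  exact: filterS nK.
suff : exists M, forall K : d.+1.-tuple 'rV[R]_d, K \in Th ->
    forall x, Om x -> (convex_hull K)° x -> `|g x| <= M.
  by move=> [M gM]; exists M => x [Omx [K KTh Kx]]; exact: gM KTh x Omx Kx.
have [_ _ bOm _] := hOm.
have {gP}: forall K : d.+1.-tuple 'rV[R]_d, K \in Th -> exists M,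
    forall x, Om x -> (convex_hull K)° x -> `|g x| <= M.
  move=> K KTh; have [G cG gG] := gP K KTh.
  have [M GM] := continuous_bounded_on bOm cG.
  by exists M => x Omx Kx; rewrite gG//; exact: GM.
elim: Th => [_|K s IH gK]; first by exists 0.
have [|M1 gM1] := gK K; first exact: mem_head.
have [|M2 gM2] := IH; first by move=> L Ls; apply: gK; rewrite inE Ls orbT.
exists (Num.max M1 M2) => L; rewrite inE => /orP[/eqP ->|Ls] x Omx Lx.
  by rewrite le_max gM1.
by rewrite le_max (gM2 L) ?orbT.
Qed.

Lemma Wh_bounded_C1 Gu j u : Wh Om Gu Th j u -> bounded_C1 D u.
Proof.
move=> [Phu _] k; have [_ uP] := Phu k.
have {}uP K : K \in Th -> exists2 F, C1 F &
    forall x, (convex_hull K)° x -> {near x, (fun y => u y ord0 k) =1 F}.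
  move=> /uP[p _ up]; exists (fun x : 'rV[R]_d => meval (fun i => x ord0 i) p).
    exact: C1_meval.
  move=> x Kx; have nK : \forall y \near x, convex_hull K y := Kx.
  exact: filterS nK.
split.
- apply: bounded_cont_piecewise => K /uP[F CF uF]; exists F.
    exact: C1_continuous.
  by move=> x /uF /nbhs_singleton.
- move=> x [_ [K /uP[F [dF _] uF] Kx]].
  by have [] := near_is_diff (uF x Kx) (differentiableP (dF x)).
- move=> h; apply: bounded_cont_piecewise => K /uP[F [dF cF] uF].
  exists (fun x => 'd F x h); first exact: cF.
  move=> x Kx.
  by have [_ ->] := near_is_diff (uF x Kx) (differentiableP (dF x)).
Qed.

End elements.

(** * Discrete representation of a semidefinite form *)

Section symmetric_forms.
Variables (R : realType) (V : lmodType R) (W : set V).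
Hypothesis W0 : W 0.
Hypothesis Wlin : forall a f g, W f -> W g -> W (a *: f + g).

Definition psd_form_on (b : V -> V -> R) :=
  [/\ forall a f g h, W f -> W g -> W h -> b (a *: f + g) h = a * b f h + b g h,
      forall f g, W f -> W g -> b f g = b g f &
      forall f, W f -> 0 <= b f f].

Lemma lin_sum n (c : 'I_n -> R) (F : 'I_n -> V) :
  (forall i, W (F i)) -> W (\sum_i c i *: F i).
Proof.
move=> WF; elim/big_rec : _ => // i f _ Wf; exact: Wlin.
Qed.

Variable b : V -> V -> R.
Hypothesis hb : psd_form_on b.

Lemma form0l h : W h -> b 0 h = 0.
Proof.
move=> Wh; have [bl _ _] := hb; have := bl 1 0 0 h W0 W0 Wh.
by rewrite scale1r addr0 mul1r => /eqP; rewrite -subr_eq0 opprD addrA subrr sub0r oppr_eq0 => /eqP.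
Qed.

Lemma form_suml n (c : 'I_n -> R) (F : 'I_n -> V) h : (forall i, W (F i)) -> W h ->
  b (\sum_i c i *: F i) h = \sum_i c i * b (F i) h.
Proof.
move=> WF Wh; have [bl _ _] := hb.
pose P f r := W f /\ b f h = r.
suff [] : P (\sum_i c i *: F i) (\sum_i c i * b (F i) h) by [].
apply: (big_rec2 P); first by split=> //; exact: form0l.
by move=> i r f _ [Wf <-]; split; [exact: Wlin|rewrite bl].
Qed.

Lemma form_sumr n (c : 'I_n -> R) (F : 'I_n -> V) h : (forall i, W (F i)) -> W h ->
  b h (\sum_i c i *: F i) = \sum_i c i * b h (F i).
Proof.
move=> WF Wh; have [_ bs _] := hb; rewrite bs//; last exact: lin_sum.
by rewrite form_suml//; apply: eq_bigr => i _; rewrite bs.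
Qed.

Lemma form_scalel r f h : W f -> W h -> b (r *: f) h = r * b f h.
Proof.
move=> Wf Wh; have [bl _ _] := hb.
by rewrite -[r *: f]addr0 bl// form0l// addr0.
Qed.

(** Expand [0 <= b (f - g) (f - g)]. *)
Lemma form_sub_ge0 f g : W f -> W g -> 2 * b g f <= b f f + b g g.
Proof.
move=> Wf Wg; have [bl bs b0] := hb.
have WB : W (-1 *: g + f) by exact: Wlin.
have := b0 _ WB; rewrite bl// [b g _]bs// [b f _]bs// !bl// (bs f g)//.
lra.
Qed.

End symmetric_forms.

Section representation.
Variables (R : realType) (V : lmodType R) (W : set V).
Hypothesis W0 : W 0.
Hypothesis Wlin : forall a f g, W f -> W g -> W (a *: f + g).
Variables a b : V -> V -> R.
Hypotheses (ha : psd_form_on W a) (hb : psd_form_on W b).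
Hypothesis null : forall f g, W f -> W g -> b f f = 0 -> a f g = 0.

(** Let [M] be the Gram matrix of [G] for [b].  The system to be solved has the row
[l] of the values of [a _ f] as right-hand side, and it is solvable as soon as
the kernel of [M] is contained in the kernel of [l].  A vector of coefficients
in the kernel of [M] defines a combination [y] of [G] with [b y y = 0], and then
[a y f = 0]. *)
Lemma ord_representation n (G : 'I_n -> V) (f : V) : (forall i, W (G i)) -> W f ->
  exists2 w, W w & forall i, b (G i) w = a (G i) f.
Proof.
move=> WG Wf; have [_ bs _] := hb.
pose M := \matrix_(i, j) b (G i) (G j).
pose l := \row_j a (G j) f.
have /submxP[x lE] : (l <= M)%MS.
  rewrite submxE; apply/eqP/matrixP => i k; rewrite (ord1 i) [RHS]mxE.
  pose c j := cokermx M j k; pose y := \sum_j c j *: G j.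
  have Wy : W y by exact: lin_sum.
  have by0 j : b (G j) y = 0.
    rewrite (form_sumr W0 Wlin hb)//.
    have := congr1 (fun A : 'M[R]_(n, n) => A j k) (mulmx_coker M).
    rewrite !mxE => E; rewrite -[RHS]E; apply: eq_bigr => m _.
    by rewrite mxE mulrC.
  have : a y f = 0.
    apply: null => //; rewrite (form_suml W0 Wlin hb)// big1// => j _.
    by rewrite by0 mulr0.
  rewrite (form_suml W0 Wlin ha)// => E; rewrite -[RHS]E mxE.
  by apply: eq_bigr => j _; rewrite mxE mulrC.
exists (\sum_i x ord0 i *: G i); first exact: lin_sum.
move=> j; rewrite (form_sumr W0 Wlin hb)//.
have := congr1 (fun A : 'rV[R]_n => A ord0 j) lE; rewrite !mxE => ->.
by apply: eq_bigr => i _; rewrite mxE bs.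
Qed.

Lemma representation (I : finType) (G : I -> V) (f : V) :
  (forall i, W (G i)) -> W f ->
  exists2 w, W w & forall i, b (G i) w = a (G i) f.
Proof.
move=> WG Wf.
have [w Ww bw] := @ord_representation #|I| (G \o enum_val) f (fun i => WG (enum_val i)) Wf.
by exists w => // i; have := bw (enum_rank i); rewrite /= enum_rankK.
Qed.

End representation.

Section time_polynomials.
Variables (R : realType) (V : lmodType R) (W : set V).
Hypothesis W0 : W 0.
Hypothesis Wlin : forall a f g, W f -> W g -> W (a *: f + g).
Variables (b : V -> V -> R) (l : nat).
Hypothesis hb : psd_form_on W b.
Implicit Types phi : 'I_l.+1 -> V.

Definition timepoly phi (s : R) : V := \sum_(i < l.+1) s ^+ i *: phi i.

Definition dtimepoly phi (s : R) : V := \sum_(i < l.+1) (s ^+ i.-1 *+ i) *: phi i.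

(** The polynomial [s |-> b (timepoly phi s) (timepoly phi s)]. *)
Definition formpoly phi : {poly R} :=
  \sum_(i < l.+1) \sum_(k < l.+1) (b (phi i) (phi k))%:P * ('X^i * 'X^k).

Lemma horner_formpoly phi s : (forall i, W (phi i)) ->
  (formpoly phi).[s] = b (timepoly phi s) (timepoly phi s).
Proof.
move=> Wphi; rewrite (form_suml W0 Wlin hb)//; last exact: lin_sum.
rewrite /formpoly horner_sum; apply: eq_bigr => i _.
rewrite (form_sumr W0 Wlin hb)// horner_sum mulr_sumr; apply: eq_bigr => k _.
by rewrite hornerM hornerC hornerM !hornerXn; ring.
Qed.

Lemma horner_deriv_formpoly phi s : (forall i, W (phi i)) ->
  (formpoly phi)^`().[s] = 2 * b (dtimepoly phi s) (timepoly phi s).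
Proof.
move=> Wphi; have [_ bs _] := hb.
have Wt : W (timepoly phi s) by exact: lin_sum.
have Wd : W (dtimepoly phi s) by exact: lin_sum.
transitivity (b (dtimepoly phi s) (timepoly phi s) +
              b (timepoly phi s) (dtimepoly phi s)); last first.
  by rewrite (bs (timepoly phi s))//; ring.
rewrite [X in X + _](form_suml W0 Wlin hb)// [X in _ + X](form_suml W0 Wlin hb)//.
rewrite -big_split /= /formpoly raddf_sum horner_sum; apply: eq_bigr => i _.
rewrite !(form_sumr W0 Wlin hb)// raddf_sum horner_sum !mulr_sumr -big_split /=.
apply: eq_bigr => k _.
rewrite derivM derivC mul0r add0r derivM !derivXn hornerM hornerC hornerD.
rewrite !hornerM !hornerMn !hornerXn.
by move: (s ^+ i.-1 *+ i) (s ^+ k.-1 *+ k) (s ^+ i) (s ^+ k) => *; ring.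
Qed.

End time_polynomials.

(** * The elastic form and the L2 product *)

Section contraction.
Variables (R : realType) (d : nat).
Implicit Types (A B X : 'M[R]_d).

Lemma contractC m n (A B : 'M[R]_(m, n)) : contract A B = contract B A.
Proof. by apply: eq_bigr => i _; apply: eq_bigr => k _; rewrite mulrC. Qed.

Lemma contract_lin m n a (A B X : 'M[R]_(m, n)) :
  contract (a *: A + B) X = a * contract A X + contract B X.
Proof.
rewrite /contract mulr_sumr -big_split /=; apply: eq_bigr => i _.
rewrite mulr_sumr -big_split /=; apply: eq_bigr => k _.
by rewrite !mxE mulrDl mulrA.
Qed.

Lemma contract_ge0 m n (A : 'M[R]_(m, n)) : 0 <= contract A A.
Proof. by apply: sumr_ge0 => i _; apply: sumr_ge0 => k _; rewrite -expr2 sqr_ge0. Qed.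

Lemma contract_eq0 m n (A : 'M[R]_(m, n)) : contract A A = 0 -> A = 0.
Proof.
move=> A0; apply/matrixP => i k; rewrite mxE; apply/eqP.
have r0 i' : 0 <= \sum_k' A i' k' * A i' k'.
  by apply: sumr_ge0 => k' _; rewrite -expr2 sqr_ge0.
move/eqP: A0; rewrite psumr_eq0// => /allP/(_ i (mem_index_enum _)) /=.
rewrite psumr_eq0 => [/allP/(_ k (mem_index_enum _)) /=|k' _].
  by rewrite mulf_eq0 orbb.
by rewrite -expr2 sqr_ge0.
Qed.

Lemma apply4_lin (C : tensor4 R d) a A B :
  apply4 C (a *: A + B) = a *: apply4 C A + apply4 C B.
Proof.
apply/matrixP => i j; rewrite !mxE mulr_sumr -big_split /=; apply: eq_bigr => k _.
rewrite mulr_sumr -big_split /=; apply: eq_bigr => m _.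
by rewrite !mxE; ring.
Qed.

Lemma contract_apply4E (C : tensor4 R d) A B : contract (apply4 C A) B =
  \sum_i \sum_j \sum_k \sum_m C i j k m * A k m * B i j.
Proof.
apply: eq_bigr => i _; apply: eq_bigr => j _; rewrite mxE mulr_suml.
by apply: eq_bigr => k _; rewrite mulr_suml.
Qed.

Definition major_symmetric (C : tensor4 R d) := forall i j k m, C i j k m = C k m i j.

(** Exchange the two pairs of summation indices. *)
Lemma contract_apply4C (C : tensor4 R d) A B : major_symmetric C ->
  contract (apply4 C A) B = contract (apply4 C B) A.
Proof.
move=> symC; rewrite !contract_apply4E !pair_big /=.
rewrite (reindex (fun p : 'I_d * 'I_d * 'I_d * 'I_d => (p.1.2, p.2, p.1.1.1, p.1.1.2))) /=; last first.
  by exists (fun p : 'I_d * 'I_d * 'I_d * 'I_d => (p.1.2, p.2, p.1.1.1, p.1.1.2)) => -[[[]]].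
by apply: eq_bigr => -[[[i j] k] m] _ /=; rewrite symC; ring.
Qed.

(** The thermal correction contributes [Theta0 / c] times the square of [m : A]. *)
Lemma adiabatic_ge0 (C : tensor4 R d) (c Theta0 : R) (m : 'M[R]_d) A :
  0 < c -> 0 < Theta0 -> positive_on_sym C -> A^T = A ->
  0 <= contract (apply4 (adiabatic C c Theta0 m) A) A.
Proof.
move=> c0 T0 Cpos Asym.
have -> : contract (apply4 (adiabatic C c Theta0 m) A) A =
    \sum_i \sum_j \sum_k \sum_l C i j k l * A i j * A k l +
    Theta0 / c * contract m A ^+ 2.
  rewrite contract_apply4E expr2 {1}/contract mulr_suml mulr_sumr -big_split /=.
  apply: eq_bigr => i _; rewrite mulr_suml mulr_sumr -big_split /=.
  apply: eq_bigr => j _; rewrite /contract !mulr_sumr -big_split /=.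
  apply: eq_bigr => k _; rewrite !mulr_sumr -big_split /=.
  by apply: eq_bigr => l _; rewrite /adiabatic; ring.
apply: addr_ge0; last by rewrite mulr_ge0 ?sqr_ge0// divr_ge0// ltW.
have [->|A0] := eqVneq A 0; last exact/ltW/Cpos.
rewrite big1// => i _; rewrite big1// => j _; rewrite big1// => k _.
by rewrite big1// => l _; rewrite !mxE !mulr0.
Qed.

Lemma strain_sym (u : 'rV[R]_d -> 'rV[R]_d) x : (strain u x)^T = strain u x.
Proof. by rewrite /strain linearZ linearD /= trmxK addrC. Qed.

End contraction.

Section forms.
Variables (R : realType) (d : nat) (Om : set 'rV[R]_d).
Variable Th : seq (d.+1.-tuple 'rV[R]_d).
Hypotheses (hOm : is_bounded_domain Om) (hTh : is_triangulation (closure Om) Th).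
Local Notation mu := (lebesgue_rV R d).
Local Notation D := (element_interiors Om Th).
Local Notation V := ('rV[R]_d -> 'rV[R]_d).

Let oD : open D. Proof. exact: open_element_interiors. Qed.

Lemma Rintegral_lin (F G H : 'rV[R]_d -> R) a :
  bounded_cont D F -> bounded_cont D G -> (forall x, D x -> H x = a * F x + G x) ->
  \int[mu]_(x in Om) H x = a * \int[mu]_(x in Om) F x + \int[mu]_(x in Om) G x.
Proof.
move=> bF bG HE; have bD : bounded_set D by exact: bounded_element_interiors.
rewrite !(eq_Rintegral_element_interiors hTh (fun _ _ => erefl)).
have mD := open_measurable_rV oD.
have iF := bounded_cont_integrable oD bD bF.
have iG := bounded_cont_integrable oD bD bG.
have iaF := bounded_cont_integrable oD bD (bounded_contZ a bF).
rewrite -RintegralZl// -RintegralD//.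
by apply: eq_Rintegral => x /set_mem; exact: HE.
Qed.

Lemma bounded_cont_contract m n (A B : 'rV[R]_d -> 'M[R]_(m, n)) :
  (forall i k, bounded_cont D (fun x => A x i k)) ->
  (forall i k, bounded_cont D (fun x => B x i k)) ->
  bounded_cont D (fun x => contract (A x) (B x)).
Proof.
move=> bA bB; apply: bounded_cont_sum => i; apply: bounded_cont_sum => k.
exact: bounded_contM.
Qed.

Lemma bounded_cont_apply4 (C : tensor4 R d) (A : 'rV[R]_d -> 'M[R]_d) :
  (forall i k, bounded_cont D (fun x => A x i k)) ->
  forall i k, bounded_cont D (fun x => apply4 C (A x) i k).
Proof.
move=> bA i k.
rewrite (_ : (fun x => _) = fun x => \sum_p \sum_q C i k p q * A x p q); last first.
  by apply/funext => x; rewrite mxE.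
apply: bounded_cont_sum => p; apply: bounded_cont_sum => q.
exact: bounded_contZ.
Qed.

Lemma bounded_C1_coord u : bounded_C1 D u -> forall i k, bounded_cont D (fun x => u x i k).
Proof. by move=> ru i k; rewrite (ord1 i); have [] := ru k. Qed.

Lemma l2_psd_form : psd_form_on (bounded_C1 D) (l2 Om : V -> V -> R).
Proof.
split=> [a f g h rf rg rh|f g _ _|f _].
- apply: Rintegral_lin.
  + by apply: bounded_cont_contract; exact: bounded_C1_coord.
  + by apply: bounded_cont_contract; exact: bounded_C1_coord.
  + by move=> x _; exact: contract_lin.
- by apply: eq_Rintegral => x _; exact: contractC.
- by apply: Rintegral_ge0 => x _; exact: contract_ge0.
Qed.

Variable C : tensor4 R d.
Hypothesis symC : major_symmetric C.
Hypothesis posC : forall A : 'M[R]_d, A^T = A -> 0 <= contract (apply4 C A) A.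

Definition elastic_form (f g : V) : R :=
  l2 Om (fun x => apply4 C (strain f x)) (strain g).

Lemma bounded_cont_elastic f g : bounded_C1 D f -> bounded_C1 D g ->
  bounded_cont D (fun x => contract (apply4 C (strain f x)) (strain g x)).
Proof.
move=> rf rg; apply: bounded_cont_contract; last first.
  by move=> i k; exact: bounded_cont_strain.
by apply: bounded_cont_apply4 => i k; exact: bounded_cont_strain.
Qed.

Lemma elastic_psd_form : psd_form_on (bounded_C1 D) elastic_form.
Proof.
split=> [a f g h rf rg rh|f g _ _|f _].
- apply: Rintegral_lin; [exact: bounded_cont_elastic|exact: bounded_cont_elastic|].
  by move=> x Dx; rewrite (strain_lin a rf rg Dx) apply4_lin contract_lin.
- by apply: eq_Rintegral => x _; exact: contract_apply4C.
- by apply: Rintegral_ge0 => x _; apply: posC; exact: strain_sym.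
Qed.

(** A function of zero L2 norm vanishes pointwise on the open set [D], so its
Jacobian vanishes there as well. *)
Lemma l2_null_elastic f g : bounded_C1 D f -> l2 Om f f = 0 -> elastic_form f g = 0.
Proof.
move=> rf f0.
have bf : bounded_cont D (fun x => contract (f x) (f x)).
  by apply: bounded_cont_contract; exact: bounded_C1_coord.
have fD x : D x -> f x = 0.
  move=> Dx; apply: contract_eq0.
  apply: (Rintegral_open_eq0 oD _ bf) => //.
  - exact: bounded_element_interiors.
  - rewrite -[RHS]f0; apply/esym.
    exact: (eq_Rintegral_element_interiors hTh).
  - by move=> y; exact: contract_ge0.
rewrite /elastic_form /l2 (@eq_Rintegral_element_interiors _ _ _ _ hTh _ (cst 0)).
  by rewrite Rintegral_cst ?mul0r//; exact: open_measurable_rV.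
move=> x Dx; rewrite (eq_strain oD fD (bounded_C10 D) Dx).
have z : strain (0 : V) x = 0.
  have := strain_lin 1 (bounded_C10 D) (bounded_C10 D) Dx.
  by rewrite scaler0 addr0 scale1r -[X in X = _]addr0 => /addrI.
rewrite z; have -> : apply4 C 0 = 0.
  by have := apply4_lin C 1 0 0; rewrite scaler0 addr0 scale1r -[X in X = _]addr0 => /addrI.
by rewrite /Defs.contract big1// => i _; rewrite big1// => k _; rewrite mxE mul0r.
Qed.

Lemma energyME rho f g : bounded_C1 D f -> bounded_C1 D g ->
  energyM Om C rho f g = 2^-1 * (elastic_form f f + rho * l2 Om g g).
Proof.
move=> rf rg; rewrite /energyM; congr (_ * _); rewrite addrC.
apply: Rintegral_lin.
- by apply: bounded_cont_contract; exact: bounded_C1_coord.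
- exact: bounded_cont_elastic.
- by move=> x _; rewrite addrC contractC.
Qed.

Lemma eq_l2 m n (f g f' g' : 'rV[R]_d -> 'M[R]_(m, n)) :
  (forall x, Om x -> f x = f' x) -> (forall x, Om x -> g x = g' x) ->
  l2 Om f g = l2 Om f' g'.
Proof. by move=> ff' gg'; apply: eq_Rintegral => x /set_mem Omx; rewrite ff'// gg'. Qed.

Lemma eq_elastic f g f' g' : bounded_C1 D f' -> bounded_C1 D g' ->
  (forall x, Om x -> f x = f' x) -> (forall x, Om x -> g x = g' x) ->
  elastic_form f g = elastic_form f' g'.
Proof.
move=> rf rg ff gg.
have onD h : \int[mu]_(x in Om) h x = \int[mu]_(x in D) h x.
  exact: eq_Rintegral_element_interiors.
rewrite /elastic_form /l2 [LHS]onD [RHS]onD; apply: eq_Rintegral => x /set_mem Dx.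
have sf : strain f x = strain f' x by apply: (eq_strain oD _ rf Dx) => y [/ff].
have sg : strain g x = strain g' x by apply: (eq_strain oD _ rg Dx) => y [/gg].
exact: (congr2 (fun A B => contract (apply4 C A) B) sf sg).
Qed.

Lemma eq_energyM rho f g f' g' : bounded_C1 D f' ->
  (forall x, Om x -> f x = f' x) -> (forall x, Om x -> g x = g' x) ->
  energyM Om C rho f g = energyM Om C rho f' g'.
Proof.
move=> rf ff gg.
have onD h : \int[mu]_(x in Om) h x = \int[mu]_(x in D) h x.
  exact: eq_Rintegral_element_interiors.
rewrite /energyM; congr (_ * _); rewrite [LHS]onD [RHS]onD.
apply: eq_Rintegral => x /set_mem Dx.
have sf : strain f x = strain f' x by apply: (eq_strain oD _ rf Dx) => y [/ff].
have gx : g x = g' x by apply: gg; have [] := Dx.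
exact: (congr2 (fun A z => contract A (apply4 C A) + rho * contract z z) sf gx).
Qed.

End forms.

(** * Finite element functions polynomial in time *)

Section finite_element_space.
Variables (R : realType) (d : nat) (Om Gu : set 'rV[R]_d).
Variables (Th : seq (d.+1.-tuple 'rV[R]_d)) (j : nat).

Lemma Ph0 : Ph Om Th j (fun _ => 0).
Proof.
split; first by apply: continuous_subspaceT => x; exact: cst_continuous.
by move=> K _; exists 0; [rewrite mmeasure0|move=> x _; rewrite meval0].
Qed.

Lemma Ph_lin a f g : Ph Om Th j f -> Ph Om Th j g ->
  Ph Om Th j (fun x => a * f x + g x).
Proof.
move=> [cf pf] [cg pg]; split.
  by move=> x; apply: cvgD (cg x); apply: cvgM (cf x); exact: cvg_cst.
move=> K KTh; have [p pj fp] := pf K KTh; have [q qj gq] := pg K KTh.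
exists (a *: p + q) => [|x Kx]; last by rewrite mevalD mevalZ fp// gq.
apply: (leq_trans (mmeasureD_le _ _ _)); rewrite geq_max qj andbT.
exact: leq_trans (mmeasureZ_le _ _ _) pj.
Qed.

(** In [Wh] and [WhQ] the boundary condition equates the entry functions of the
vectors rather than the vectors themselves. *)
Lemma matrix_fun_eq0 (A : 'rV[R]_d) : A = 0 :> ('I_1 -> 'I_d -> R) <-> A = 0.
Proof.
split=> [A0|->]; last by apply/funext => i; apply/funext => k; rewrite mxE.
by apply/matrixP => i k; rewrite mxE A0.
Qed.

Lemma Wh0 : Wh Om Gu Th j 0.
Proof.
split=> [k|x _]; last exact/matrix_fun_eq0.
have -> : (fun x => (0 : 'rV[R]_d -> 'rV[R]_d) x ord0 k) = fun=> 0.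
  by apply/funext => x; rewrite mxE.
exact: Ph0.
Qed.

Lemma Wh_lin a u v : Wh Om Gu Th j u -> Wh Om Gu Th j v -> Wh Om Gu Th j (a *: u + v).
Proof.
move=> [pu u0] [pv v0]; split=> [k|x Gx].
  rewrite (_ : (fun x => _) = fun x => a * u x ord0 k + v x ord0 k).
    exact: Ph_lin.
  by apply/funext => x; rewrite !fctE !mxE.
apply/matrix_fun_eq0; rewrite !fctE.
have /matrix_fun_eq0 -> := u0 x Gx; have /matrix_fun_eq0 -> := v0 x Gx.
by rewrite scaler0 addr0.
Qed.

Variable l : nat.

Lemma timepolyE (phi : 'I_l.+1 -> 'rV[R]_d -> 'rV[R]_d) s x :
  timepoly phi s x = \sum_(i < l.+1) s ^+ i *: phi i x.
Proof. by rewrite /timepoly fct_sumE. Qed.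

Lemma WhQ_timepoly a b (phi : 'I_l.+1 -> 'rV[R]_d -> 'rV[R]_d) : (forall i, Wh Om Gu Th j (phi i)) ->
  WhQ Om Gu Th a b j l (fun x s => timepoly phi s x).
Proof.
move=> Wphi; split=> [k|x s Gx _].
  exists (fun i x => phi i x ord0 k) => [i|x s _ _]; first by have [+ _] := Wphi i; apply.
  rewrite timepolyE summxE; apply: eq_bigr => i _.
  by rewrite mxE mulrC.
apply/matrix_fun_eq0; rewrite timepolyE big1// => i _.
by have [_ /(_ x Gx)/matrix_fun_eq0 ->] := Wphi i; rewrite scaler0.
Qed.

(** A nonzero polynomial of size at most [n] cannot vanish at the [n.+1] equally
spaced points [r k] of the interval. *)
Lemma polynomial_eq0_on_itv a b n (c : 'I_n -> R) : a < b ->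
  (forall s, s \in `[a, b] -> \sum_i c i * s ^+ i = 0) -> forall i, c i = 0.
Proof.
move=> ab c0 i; pose p := \poly_(k < n) (if insub k is Some k' then c k' else 0).
have pE k : p`_(nat_of_ord k) = c k by rewrite coef_poly ltn_ord valK.
rewrite -pE; suff -> : p = 0 by rewrite coef0.
apply/eqP/negPn/negP => p0.
pose r (k : nat) : R := a + (b - a) / n.+1%:R * k%:R.
have h0 : 0 < (b - a) / n.+1%:R by rewrite divr_gt0// subr_gt0.
pose rs := [seq r k | k <- iota 0 n.+1].
have rs_uniq : uniq rs.
  rewrite map_inj_uniq ?iota_uniq// => k k' /addrI /(mulfI (lt0r_neq0 h0)) /eqP.
  by rewrite eqr_nat => /eqP.
have rs_root : all (root p) rs.
  apply/allP => _ /mapP[k + ->]; rewrite mem_iota add0n ltnS => /= kn.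
  rewrite /root horner_poly -[X in _ == X](c0 (r k)).
    by apply/eqP; apply: eq_bigr => m _; rewrite valK.
  rewrite in_itv /= lerDl mulr_ge0 ?(ltW h0)//= -lerBrDl -mulrA ler_piMr//.
    by rewrite subr_ge0 ltW.
  by rewrite mulrC ler_pdivrMr// mul1r ler_nat leqW.
have := max_poly_roots p0 rs_root rs_uniq.
by rewrite size_map size_iota ltnNge (leq_trans (size_poly _ _)).
Qed.

Hypothesis GuOm : Gu `<=` closure Om.

(** The coefficients inherit the boundary condition: at a point of [Gu] the
polynomial in time vanishes on a whole interval.  The hypothesis on [Gu] is
needed there because the expansion in powers of time is only given on the closed
domain. *)
Lemma WhQ_decomposition a b u : a < b -> WhQ Om Gu Th a b j l u ->
  exists2 phi : 'I_l.+1 -> 'rV[R]_d -> 'rV[R]_d,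
    forall i, Wh Om Gu Th j (phi i) &
    forall x s, closure Om x -> s \in `[a, b] -> u x s = timepoly phi s x.
Proof.
move=> ab [Su u0].
have /choice[c cP] : forall k : 'I_d, exists phi : 'I_l.+1 -> 'rV[R]_d -> R,
    (forall i, Ph Om Th j (phi i)) /\
    forall x s, closure Om x -> s \in `[a, b] ->
      u x s ord0 k = \sum_(i < l.+1) phi i x * s ^+ i.
  by move=> k; have [phi Pphi phiE] := Su k; exists phi.
exists (fun i x => \row_k c k i x) => [i|x s Omx sab]; last first.
  apply/rowP => k; have [_ ->//] := cP k; rewrite timepolyE summxE.
  by apply: eq_bigr => i _; rewrite !mxE mulrC.
split=> [k|x Gx].
  rewrite (_ : (fun x => _) = c k i); first by have [] := cP k.
  by apply/funext => x; rewrite mxE.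
apply/matrix_fun_eq0/rowP => k; rewrite !mxE; move: i.
apply: (polynomial_eq0_on_itv ab) => s sab.
have [_ <-//] := cP k; first by have /matrix_fun_eq0 -> := u0 x s Gx sab; rewrite mxE.
exact: GuOm.
Qed.

End finite_element_space.

Section time_traces.
Variables (R : realType) (d l : nat).
Variable phi : 'I_l.+1 -> 'rV[R]_d -> 'rV[R]_d.

Lemma is_derive_timepoly (x : 'rV[R]_d) (s : R) :
  is_derive s (1 : R) (fun r : R => timepoly phi r x) (dtimepoly phi s x).
Proof.
have -> : (fun r => timepoly phi r x) =
    \sum_(i < l.+1) (fun r => horner 'X^i r *: phi i x).
  apply/funext => r; rewrite fct_sumE timepolyE; apply: eq_bigr => i _.
  by rewrite hornerXn.
have -> : dtimepoly phi s x = \sum_(i < l.+1) (s ^+ i.-1 *+ i) *: phi i x.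
  by rewrite /dtimepoly fct_sumE.
apply: is_derive_sum => i.
have dk : differentiable (horner ('X^i : {poly R})) s.
  exact/derivable1_diffP/derivable_horner.
have dF := differentiableZl (phi i x) dk.
apply: DeriveDef; first exact: diff_derivable.
rewrite deriveE//.
have /funeqP/(_ 1) -> := diffZl (phi i x) dk.
rewrite -deriveE// (@derive_val _ _ _ _ _ _ _ (is_derive_poly 'X^i s)).
by rewrite derivXn hornerMn hornerXn.
Qed.

Lemma continuous_timepoly (x : 'rV[R]_d) : continuous (fun r : R => timepoly phi r x).
Proof.
move=> s; apply/differentiable_continuous/derivable1_diffP.
by have [] := is_derive_timepoly x s.
Qed.

Variables (a b : R) (u : 'rV[R]_d -> R -> 'rV[R]_d) (x : 'rV[R]_d).
Hypothesis ab : a < b.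
Hypothesis uE : forall s, s \in `[a, b] -> u x s = timepoly phi s x.

Lemma dotQ_timepoly s : s \in `]a, b[ -> dotQ u x s = dtimepoly phi s x.
Proof.
move=> sab; rewrite /dotQ derive1E.
have nab : \forall r \near s, r \in `]a, b[ by exact: near_in_itvoo.
have nu : \forall r \near s, timepoly phi r x = u x r.
  by apply: filterS nab => r rab; rewrite uE//; exact: subset_itv_oo_cc.
by have [_ ->] := near_eq_is_derive nu (is_derive_timepoly x s).
Qed.

Lemma right_trace_timepoly : right_trace u a x = timepoly phi a x.
Proof.
rewrite /right_trace; apply: cvg_lim => //.
apply: cvg_trans (cvg_at_right_filter (@continuous_timepoly x a)).
apply: near_eq_cvg; near=> r; rewrite uE// in_itv /=; apply/andP; split; apply: ltW.
  by near: r; exact: nbhs_right_gt.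
by near: r; exact: nbhs_right_lt.
Unshelve. all: by end_near. Qed.

Lemma left_trace_timepoly : left_trace u b x = timepoly phi b x.
Proof.
rewrite /left_trace; apply: cvg_lim => //.
apply: cvg_trans (cvg_at_left_filter (@continuous_timepoly x b)).
apply: near_eq_cvg; near=> r; rewrite uE// in_itv /=; apply/andP; split; apply: ltW.
  by near: r; exact: nbhs_left_gt.
by near: r; exact: nbhs_left_lt.
Unshelve. all: by end_near. Qed.

End time_traces.

Section time_integrals.
Variables (R : realType) (d : nat) (Om : set 'rV[R]_d) (a b : R).
Hypothesis ab : a < b.

Lemma Rintegral_deriv_poly (p : {poly R}) :
  \int[@lebesgue_measure R]_(s in `[a, b]) p^`().[s] = p.[b] - p.[a].
Proof.
rewrite /Rintegral (@continuous_FTC2 _ _ (horner p))//.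
- by apply: continuous_subspaceT; exact: continuous_horner.
- split=> [s _| |]; first exact: derivable_horner.
    by apply: cvg_at_right_filter; exact: continuous_horner.
  by apply: cvg_at_left_filter; exact: continuous_horner.
- by move=> s _; rewrite derivE.
Qed.

(** The endpoints are excluded because the discrete fields are arbitrary outside
the slab, so their time derivatives are unknown there. *)
Lemma eq_Rintegral_itv (F G : R -> R) : (forall s, s \in `]a, b[ -> F s = G s) ->
  \int[@lebesgue_measure R]_(s in `[a, b]) F s =
  \int[@lebesgue_measure R]_(s in `[a, b]) G s.
Proof.
move=> FG; apply: (@eq_Rintegral_off_null _ _ _ (@lebesgue_measure R)
  (`]a, b[%classic : set R) _ ([set a; b] : set R)).
- exact: subset_itv_oo_cc.
- move=> s [/= + /negP]; rewrite !in_itv /= => /andP[].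
  rewrite le_eqVlt => /orP[/eqP <- _ _|-> /=]; first by left.
  by rewrite le_eqVlt => /orP[/eqP -> _|->//]; right.
- exact: measurableU.
- by apply: countable_lebesgue_measure0; exact/finite_set_countable/finite_set2.
- by move=> s /set_mem; exact: FG.
Qed.

Lemma l2Q_deriv m n (f g : 'rV[R]_d -> R -> 'M[R]_(m, n)) (p : {poly R}) :
  (forall s, s \in `]a, b[ -> l2 Om (f^~ s) (g^~ s) = p^`().[s]) ->
  l2Q Om a b f g = p.[b] - p.[a].
Proof. by move=> fgp; rewrite -Rintegral_deriv_poly; exact: eq_Rintegral_itv. Qed.

End time_integrals.

(** * Energy decay *)

(** Here [ub], [ua], [um] stand for the elastic form of the displacement at the
end of the slab, after the initial jump and before it, [umua] for the mixed value
across the jump, the [v]'s for the corresponding L2 products of the velocity, and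
[p] for the coupling term, which occurs with both signs. *)
Lemma energy_balance (R : realFieldType)
    (rho ub ua um umua vb va vm vmva p : R) : 0 < rho ->
  2^-1 * (ub - ua) - p + rho / 2 * (vb - va) + p + ua + rho * va =
    umua + rho * vmva ->
  2 * umua <= ua + um -> 2 * vmva <= va + vm ->
  2^-1 * (ub + rho * vb) <= 2^-1 * (um + rho * vm).
Proof. by move=> rho0 E hu; rewrite -(ler_pM2l rho0) => hv; lra. Qed.

Section slab.
Variables (R : realType) (d : nat) (Om Gu : set 'rV[R]_d).
Variables (Th : seq (d.+1.-tuple 'rV[R]_d)) (j l : nat).
Hypotheses (hOm : is_bounded_domain Om) (hTh : is_triangulation (closure Om) Th).
Hypothesis GuOm : Gu `<=` closure Om.
Variables (C : tensor4 R d) (rho : R).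
Hypotheses (symC : major_symmetric C) (rho0 : 0 < rho).
Hypothesis posC : forall A : 'M[R]_d, A^T = A -> 0 <= contract (apply4 C A) A.
Local Notation D := (element_interiors Om Th).
Local Notation V := ('rV[R]_d -> 'rV[R]_d).
Local Notation W := (Wh Om Gu Th j).
Local Notation el := (elastic_form Om C).

Let W0 : W 0 := Wh0 _ _ _ _.
Let Wlin := @Wh_lin R d Om Gu Th j.
Let Wreg (f : V) : W f -> bounded_C1 D f := @Wh_bounded_C1 _ _ _ _ hOm _ _ f.

Lemma psd_form_onS (U U' : set V) b : U `<=` U' -> psd_form_on U' b -> psd_form_on U b.
Proof.
move=> UU [bl bs b0]; split.
- by move=> r f g h /UU Uf /UU Ug /UU Uh; exact: bl.
- by move=> f g /UU Uf /UU Ug; exact: bs.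
- by move=> f /UU; exact: b0.
Qed.

Let hb : psd_form_on W (l2 Om : V -> V -> R) := psd_form_onS Wreg (l2_psd_form hOm hTh).
Let ha : psd_form_on W el := psd_form_onS Wreg (elastic_psd_form hOm hTh symC posC).

(** [um'] and [vm'] are finite element functions that agree on the domain with the
data [um] and [vm] from the preceding slab; those are traces, whose values
outside the closed domain are arbitrary. *)
Lemma slab_energy a b um vm um' vm' u v : a < b -> W um' -> W vm' ->
  (forall x, Om x -> um x = um' x) -> (forall x, Om x -> vm x = vm' x) ->
  WhQ Om Gu Th a b j l u -> WhQ Om Gu Th a b j l v ->
  (forall w phi, WhQ Om Gu Th a b j l w -> WhQ Om Gu Th a b j l phi ->
     slab_equation Om a b C rho um vm u v w phi) ->
  energyM Om C rho (left_trace u b) (left_trace v b) <= energyM Om C rho um vm.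
Proof.
move=> ab Wum Wvm umE vmE hu hv eqn.
have [phi Wphi uE] := WhQ_decomposition GuOm ab hu.
have [psi Wpsi vE] := WhQ_decomposition GuOm ab hv.
have {}uE x : Om x -> forall s, s \in `[a, b] -> u x s = timepoly phi s x.
  by move=> Omx s; apply: uE; exact: subset_closure.
have {}vE x : Om x -> forall s, s \in `[a, b] -> v x s = timepoly psi s x.
  by move=> Omx s; apply: vE; exact: subset_closure.
have oo_cc s : s \in `]a, b[ -> s \in `[a, b] by exact: subset_itv_oo_cc.
have Wt (F : 'I_l.+1 -> V) s : (forall i, W (F i)) -> W (timepoly F s).
  by move=> WF; exact: lin_sum.
have Wd (F : 'I_l.+1 -> V) s : (forall i, W (F i)) -> W (dtimepoly F s).
  by move=> WF; exact: lin_sum.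
(* all the functions against which the discrete representative is used *)
pose G (g : unit + ('I_l.+1 + 'I_l.+1)) : V :=
  match g with inl _ => um' | inr (inl i) => phi i | inr (inr i) => psi i end.
have WG g : W (G g) by case: g => [[]|[i|i]]; [exact: Wum|exact: Wphi|exact: Wpsi].
have null f g : W f -> W g -> l2 Om f f = 0 -> el f g = 0.
  by move=> /Wreg rf _ f0; exact: (l2_null_elastic hOm hTh C g rf f0).
have /choice[omega omegaP] : forall i, exists w, W w /\
    forall g, l2 Om (G g) w = el (G g) (phi i).
  move=> i; have [w Ww wE] := representation W0 Wlin ha hb null WG (Wphi i).
  by exists w.
have Womega i : W (omega i) by have [] := omegaP i.
(* [timepoly omega s] represents the elastic form of [timepoly phi s] on the
   span of [G], which contains the time derivatives too *)
pose rep f := forall s, l2 Om f (timepoly omega s) = el f (timepoly phi s).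
have repG g : rep (G g).
  move=> s; rewrite (form_sumr W0 Wlin hb)// (form_sumr W0 Wlin ha)//.
  by apply: eq_bigr => i _; have [_ ->] := omegaP i.
have rep_sum (c : 'I_l.+1 -> R) (F : 'I_l.+1 -> V) : (forall i, W (F i)) ->
    (forall i, rep (F i)) -> rep (\sum_(i < l.+1) c i *: F i).
  move=> WF repF s; rewrite (form_suml W0 Wlin hb)//; last exact: Wt.
  rewrite (form_suml W0 Wlin ha)//; last exact: Wt.
  by apply: eq_bigr => i _; rewrite repF.
have rep_um : rep um' by exact: (repG (inl tt)).
have rep_phi i : rep (phi i) by exact: (repG (inr (inl i))).
have rep_psi i : rep (psi i) by exact: (repG (inr (inr i))).
have := eqn _ v (WhQ_timepoly a b Womega) hv.
rewrite /slab_equation.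
have -> : l2Q Om a b (dotQ u) (fun x s => timepoly omega s x) =
    2^-1 * (el (timepoly phi b) (timepoly phi b) - el (timepoly phi a) (timepoly phi a)).
  rewrite (@l2Q_deriv _ _ _ _ _ ab _ _ _ _ (2^-1 *: formpoly el phi)).
    by rewrite !hornerZ -mulrBr !(horner_formpoly W0 Wlin ha).
  move=> s sab; rewrite derivZ hornerZ (horner_deriv_formpoly W0 Wlin ha)//.
  rewrite mulKf// -(rep_sum _ _ Wphi rep_phi s).
  by apply: eq_l2 => // x Omx; apply: (dotQ_timepoly (uE x Omx)).
(* the coupling terms agree by symmetry of the elastic form *)
have -> : l2Q Om a b v (fun x s => timepoly omega s x) =
    l2Q Om a b (fun x s => apply4 C (strainQ u x s)) (strainQ v).
  apply: eq_Rintegral_itv => // s /oo_cc sab.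
  transitivity (l2 Om (timepoly psi s) (timepoly omega s)).
    by apply: eq_l2 => // x Omx; exact: vE.
  rewrite (rep_sum _ _ Wpsi rep_psi s).
  have [_ as_ _] := ha; rewrite as_; [|exact: Wt..].
  apply/esym; apply: (eq_elastic hOm hTh).
  - exact/Wreg/Wt.
  - exact/Wreg/Wt.
  - by move=> x Omx; exact: uE.
  - by move=> x Omx; exact: vE.
have -> : l2Q Om a b (fun x s => rho *: dotQ v x s) v = rho / 2 *
    (l2 Om (timepoly psi b) (timepoly psi b) - l2 Om (timepoly psi a) (timepoly psi a)).
  rewrite (@l2Q_deriv _ _ _ _ _ ab _ _ _ _ ((rho / 2) *: formpoly (l2 Om) psi)).
    by rewrite !hornerZ -mulrBr !(horner_formpoly W0 Wlin hb).
  move=> s sab; rewrite derivZ hornerZ (horner_deriv_formpoly W0 Wlin hb)//.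
  rewrite mulrA divfK// -(form_scalel W0 hb); [|exact: Wd|exact: Wt].
  apply: eq_l2 => x Omx; last by apply: vE => //; exact: oo_cc.
  by rewrite (dotQ_timepoly (vE x Omx)).
have wE x s : s \in `[a, b] -> timepoly omega s x = timepoly omega s x by [].
have -> : l2 Om (right_trace u a) (right_trace (fun x s => timepoly omega s x) a) =
    el (timepoly phi a) (timepoly phi a).
  rewrite -(rep_sum _ _ Wphi rep_phi a); apply: eq_l2 => x Omx.
    exact: (right_trace_timepoly ab (uE x Omx)).
  exact: (right_trace_timepoly ab (wE x)).
have -> : l2 Om (fun x => rho *: right_trace v a x) (right_trace v a) =
    rho * l2 Om (timepoly psi a) (timepoly psi a).
  rewrite -(form_scalel W0 hb); [|exact: Wt..].
  by apply: eq_l2 => x Omx; rewrite (right_trace_timepoly ab (vE x Omx)).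
have -> : l2 Om um (right_trace (fun x s => timepoly omega s x) a) =
    el um' (timepoly phi a).
  rewrite -rep_um; apply: eq_l2 => x Omx; first exact: umE.
  exact: (right_trace_timepoly ab (wE x)).
have -> : l2 Om (fun x => rho *: vm x) (right_trace v a) =
    rho * l2 Om vm' (timepoly psi a).
  rewrite -(form_scalel W0 hb); [|by []|exact: Wt].
  apply: eq_l2 => x Omx; first by rewrite vmE.
  exact: (right_trace_timepoly ab (vE x Omx)).
move=> E.
have -> : energyM Om C rho (left_trace u b) (left_trace v b) =
    energyM Om C rho (timepoly phi b) (timepoly psi b).
  apply: (eq_energyM hOm hTh); first exact/Wreg/Wt.
    by move=> x Omx; exact: (left_trace_timepoly ab (uE x Omx)).
  by move=> x Omx; exact: (left_trace_timepoly ab (vE x Omx)).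
rewrite (eq_energyM hOm hTh C rho (Wreg Wum) umE vmE).
rewrite (energyME hOm hTh C rho (Wreg (Wt _ b Wphi)) (Wreg (Wt _ b Wpsi))).
rewrite (energyME hOm hTh C rho (Wreg Wum) (Wreg Wvm)).
exact: (energy_balance rho0 E (form_sub_ge0 Wlin ha (Wt _ a Wphi) Wum)
  (form_sub_ge0 Wlin hb (Wt _ a Wpsi) Wvm)).
Qed.

End slab.

Theorem mainTheorem4 (R : realType) (d : nat) (hd : (1 <= d <= 3)%N)
    (Om Gu Gt : set 'rV[R]_d) (hOm : is_bounded_domain Om)
    (hG : boundary Om = closure (Gu `|` Gt)) (hGG : Gu `&` Gt = set0)
    (Th : seq (d.+1.-tuple 'rV[R]_d)) (hTh : is_triangulation (closure Om) Th)
    (j l : nat) (T : R) (N : nat) (t : nat -> R) (ht : is_time_partition T N t)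
    (rho c Theta0 omega kappa : R)
    (hrho : 0 < rho) (hc : 0 < c) (hTheta0 : 0 < Theta0)
    (C : tensor4 R d) (hCsym : elasticity_symmetries C)
    (hCpos : positive_on_sym C)
    (u0 v0 : 'rV[R]_d -> 'rV[R]_d)
    (hu0 : Wh Om Gu Th j u0) (hv0 : Wh Om Gu Th j v0)
    (u v : nat -> 'rV[R]_d -> R -> 'rV[R]_d)
    (hscheme : mechanical_scheme Om Gu Th j l N t
      (adiabatic C c Theta0 (thermal_tensor d omega kappa)) rho u0 v0 u v) :
  forall n, (n < N)%N ->
    energyM Om (adiabatic C c Theta0 (thermal_tensor d omega kappa)) rho
      (minus_trace t u0 u n.+1) (minus_trace t v0 v n.+1)
    <= energyM Om (adiabatic C c Theta0 (thermal_tensor d omega kappa)) rho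
      (minus_trace t u0 u n) (minus_trace t v0 v n).
Proof.
move=> n nN.
have [_ _ tlt] := ht.
have GuOm : Gu `<=` closure Om.
  move=> x Gx; have : (boundary Om) x by rewrite hG; apply: subset_closure; left.
  by case.
have symC : major_symmetric (adiabatic C c Theta0 (thermal_tensor d omega kappa)).
  by move=> i k p q; rewrite /adiabatic; have [_ _ ->] := hCsym i k p q; ring.
have posC A : A^T = A -> 0 <= contract
    (apply4 (adiabatic C c Theta0 (thermal_tensor d omega kappa)) A) A.
  exact: adiabatic_ge0.
have trace_Wh (w0 : 'rV[R]_d -> 'rV[R]_d) (w : nat -> 'rV[R]_d -> R -> 'rV[R]_d) :
    Wh Om Gu Th j w0 ->
    (forall m, (m < N)%N -> WhQ Om Gu Th (t m) (t m.+1) j l (w m)) ->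
    exists2 w', Wh Om Gu Th j w' & forall x, Om x -> minus_trace t w0 w n x = w' x.
  move=> Ww0 Ww; case: n nN => [|m] mN; first by exists w0.
  have mN' := ltnW mN.
  have [phi Wphi wE] := WhQ_decomposition GuOm (tlt m mN') (Ww m mN').
  exists (timepoly phi (t m.+1)).
    by apply: lin_sum => //; [exact: Wh0|exact: Wh_lin].
  move=> x Omx; apply: (left_trace_timepoly (tlt m mN')) => s.
  by apply: wE; exact: subset_closure.
have uW m : (m < N)%N -> WhQ Om Gu Th (t m) (t m.+1) j l (u m).
  by move=> /(hscheme m)[].
have vW m : (m < N)%N -> WhQ Om Gu Th (t m) (t m.+1) j l (v m).
  by move=> /(hscheme m)[].
have [um Wum umE] := trace_Wh u0 u hu0 uW.
have [vm Wvm vmE] := trace_Wh v0 v hv0 vW.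
have [hu hv eqn] := hscheme n nN.
exact: (slab_energy hOm hTh GuOm symC hrho posC (tlt n nN) Wum Wvm umE vmE hu hv eqn).
Qed.
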